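(* Let $H\in\mathcal N_2$ be a normal affine semigroup in $\mathbb N^2$ with extremal rays $\mathbf a_1,\mathbf a_2$ and Hilbert basis $B_H$. An element $\mathbf b\in B_H\setminus\{\mathbf a_1,\mathbf a_2\}$ is an Ulrich element in $H$ if and only if $$\mathbf c_1+\mathbf c_2\in(\mathbf b+H)\cup(\mathbf a_1+H)\cup(\mathbf a_2+H)\quad\text{for all }\mathbf c_1,\mathbf c_2\in B_H.$$
   Context: $\mathbb N=\{0,1,2,\dots\}$. $\mathcal N_2$ is the class of normal affine semigroups $H\subseteq\mathbb N^2$ generating $\mathbb Z^2$ as a group: $H$ is a finitely generated submonoid of $\mathbb N^2$ with $H=C\cap\mathbb Z^2$, where $C\subseteq\mathbb R^2$ is the (two-dimensional) cone generated by $H$. The extremal rays of $H$ are the primitive lattice vectors $\mathbf a_1,\mathbf a_2\in H$ lying on the two extremal rays (one-dimensional faces) of $C$. $B_H$ (the Hilbert basis) is the unique minimal generating set of $H$, and $\omega_H=\mathbb Z^2\cap\operatorname{relint}C$ (every element of $B_H\setminus\{\mathbf a_1,\mathbf a_2\}$ lies in $\omega_H$). Let $K$ be a field. $R=K[H]$ is the subalgebra of $K[x_1,x_2]$ spanned by the monomials $\mathbf x^{\mathbf h}$, $\mathbf h\in H$; its graded maximal ideal $\mathfrak m$ is generated by $\mathbf x^{\mathbf h}$, $0\ne\mathbf h\in H$. The canonical module $\omega_R$ is the ideal of $R$ spanned over $K$ by the monomials $\mathbf x^{\mathbf h}$, $\mathbf h\in\omega_H$. A graded Cohen–Macaulay $R$-module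 $E$ is Ulrich if its minimal number of generators equals its multiplicity $e(E)$ with respect to $\mathfrak m$; the zero module counts as Ulrich. An element $\mathbf b\in\omega_H$ is called an Ulrich element in $H$ if $E=\omega_R/\mathbf x^{\mathbf b}R$ is an Ulrich $R$-module. *)

(* Defs.v *)
From HB Require Import structures.
From mathcomp Require Import all_boot all_order all_algebra.
From mathcomp Require Import mpoly.
From mathcomp Require Import boolp classical_sets reals.

Set Implicit Arguments.
Unset Strict Implicit.
Unset Printing Implicit Defensive.

Import Order.TTheory GRing.Theory Num.Theory.
Local Open Scope classical_set_scope.
Local Open Scope quotient_scope.
Local Open Scope ring_scope.

(** * Modules over a commutative ring

    Submodules, ideals and subsets are [Prop]-valued sets; numerical invariants
    are relations between a module and a natural number. *)

Definition is_max (S : set nat) (n : nat) : Prop :=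
  S n /\ forall k, S k -> (k <= n)%N.

Definition is_min (S : set nat) (n : nat) : Prop :=
  S n /\ forall k, S k -> (n <= k)%N.

Section Modules.
Variables (A : comNzRingType) (M : lmodType A).

Definition span (S : set M) : set M := [set v | exists s : seq (A * M),
  (forall p, p \in s -> S p.2) /\ v = \sum_(p <- s) p.1 *: p.2].

Definition is_submodule (N : set M) : Prop :=
  [/\ N 0, forall u v, N u -> N v -> N (u + v) & forall a v, N v -> N (a *: v)].

(* The submodule S N, for a subset S of A. *)
Definition smul (S : set A) (N : set M) : set M :=
  span [set v | exists a u, [/\ S a, N u & v = a *: u]].

(* The submodule I ^ n M. *)
Definition powmul (I : set A) (n : nat) : set M := iter n (smul I) setT.

Definition is_min_gens : nat -> Prop :=
  is_min [set n | exists s : seq M, size s = n /\ span [set` s] = setT].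

(* The length of M / N, measured on the submodules of M containing N. *)
Definition is_colength (N : set M) : nat -> Prop :=
  is_max [set n | exists L : nat -> set M,
    [/\ forall i, (i <= n)%N -> is_submodule (L i) /\ N `<=` L i
      & forall i, (i < n)%N -> L i `<` L i.+1]].

Definition ann : set A := [set a | forall v : M, a *: v = 0].

(* [s] is an M-regular sequence contained in I. *)
Definition is_regular_seq (I : set A) (s : seq A) : Prop :=
  [/\ [set` s] `<=` I,
      forall i v, (i < size s)%N ->
        smul [set` take i s] setT (s`_i *: v) -> smul [set` take i s] setT v
    & smul [set` s] setT <> (setT : set M)].

Definition is_depth (I : set A) : nat -> Prop :=
  is_max [set n | exists s, is_regular_seq I s /\ size s = n].

End Modules.

Arguments is_min_gens {A} M _.
Arguments powmul {A} M I n.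
Arguments ann {A} M.
Arguments is_depth {A} M I _.

Definition is_ideal (A : comNzRingType) (I : set A) : Prop :=
  is_submodule (I : set A^o).

Definition ideal_gen (A : comNzRingType) (S : set A) : set A :=
  span (S : set A^o).

Definition is_prime_ideal (A : comNzRingType) (P : set A) : Prop :=
  [/\ is_ideal P, ~ P 1 & forall x y, P (x * y) -> P x \/ P y].

(* The Krull dimension of A / ann M. *)
Definition is_dim (A : comNzRingType) (M : lmodType A) : nat -> Prop :=
  is_max [set n | exists P : nat -> set A,
    [/\ forall i, (i <= n)%N -> is_prime_ideal (P i) /\ ann M `<=` P i
      & forall i, (i < n)%N -> P i `<` P i.+1]].

(* The length of M / I ^ (n + 1) M is, for large n, a polynomial in n of degree
   d = dim M; its leading coefficient is e / d!. *)
Definition is_multiplicity (A : comNzRingType) (I : set A) (M : lmodType A)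
    (e : nat) : Prop :=
  exists (d : nat) (P : {poly rat}),
    [/\ is_dim M d, size P = d.+1,
        exists n0 : nat, forall n, (n0 <= n)%N -> exists l : nat,
          is_colength (powmul M I n.+1) l /\ P.[n%:R] = l%:R
      & lead_coef P * d`!%:R = e%:R].

(* For a graded module over a positively graded ring with graded maximal ideal
   I, the depth and the dimension may be computed without localizing at I. *)
Definition is_CM (A : comNzRingType) (I : set A) (M : lmodType A) : Prop :=
  exists d, is_dim M d /\ is_depth M I d.

Definition is_Ulrich (A : comNzRingType) (I : set A) (M : lmodType A) : Prop :=
  (forall v : M, v = 0) \/
  (is_CM I M /\ exists n, is_min_gens M n /\ is_multiplicity I M n).

(** * Quotient of a module by a submodule *)

Section QuotientModule.
Variables (A : nzRingType) (M : lmodType A) (N : submodClosed M).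

Fact quotmod_zmod_closed : zmod_closed (N : {pred M}).
Proof.
by split=> [|u v uN vN]; rewrite ?rpred0 // -scaleN1r rpredD ?rpredZ.
Qed.

Definition quotmod_zmod : zmodClosed M :=
  HB.pack (N : {pred M}) (GRing.isZmodClosed.Build M (N : {pred M}) quotmod_zmod_closed).

Definition quotmod := Quotient.quot quotmod_zmod.

HB.instance Definition _ := Choice.on quotmod.
HB.instance Definition _ := GRing.Zmodule.on quotmod.

Definition quotmod_pi (v : M) : quotmod := \pi_quotmod v.

Definition quotmod_scale (a : A) (q : quotmod) : quotmod :=
  quotmod_pi (a *: repr (q : quotmod)).

Lemma quotmod_piD u v : quotmod_pi (u + v) = quotmod_pi u + quotmod_pi v.
Proof. exact: (raddfD (\pi_quotmod)). Qed.

Lemma quotmod_piP u v : quotmod_pi u = quotmod_pi v <-> u - v \in N.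
Proof.
have -> : (u - v \in N) = (quotmod_pi u == quotmod_pi v).
  exact: (Quotient.idealrBE quotmod_zmod).
by split=> [->|/eqP].
Qed.

Lemma quotmod_reprK q : quotmod_pi (repr (q : quotmod)) = q.
Proof. exact: reprK. Qed.

Lemma quotmod_scale_pi a v : quotmod_scale a (quotmod_pi v) = quotmod_pi (a *: v).
Proof.
apply/quotmod_piP; rewrite -scalerBr rpredZ //.
by apply/quotmod_piP; rewrite quotmod_reprK.
Qed.

Lemma quotmod_scaleA a b q :
  quotmod_scale a (quotmod_scale b q) = quotmod_scale (a * b) q.
Proof. by rewrite -(quotmod_reprK q) !quotmod_scale_pi scalerA. Qed.

Lemma quotmod_scale1 : left_id 1 quotmod_scale.
Proof. by move=> q; rewrite -(quotmod_reprK q) quotmod_scale_pi scale1r. Qed.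

Lemma quotmod_scaleDr : right_distributive quotmod_scale +%R.
Proof.
move=> a p q; rewrite -(quotmod_reprK p) -(quotmod_reprK q).
by rewrite -quotmod_piD !quotmod_scale_pi scalerDr quotmod_piD.
Qed.

Lemma quotmod_scaleDl q : {morph quotmod_scale^~ q : a b / a + b}.
Proof.
move=> a b; rewrite -(quotmod_reprK q).
by rewrite !quotmod_scale_pi scalerDl quotmod_piD.
Qed.

HB.instance Definition _ := GRing.Zmodule_isLmodule.Build A quotmod
  quotmod_scaleA quotmod_scale1 quotmod_scaleDr quotmod_scaleDl.

End QuotientModule.

(** * Affine semigroups in N^2

    A vector h of N^2 is the exponent h : 'X_{1..2} of the monomial 'X_[h]. *)

Record submonoid2 := Submonoid2 {
  submonoid2_pred :> {pred 'X_{1..2}};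
  submonoid2_0 : 0%MM \in submonoid2_pred;
  submonoid2_D : forall g h,
    g \in submonoid2_pred -> h \in submonoid2_pred -> (g + h)%MM \in submonoid2_pred
}.

Definition generates (B : set 'X_{1..2}) (H : submonoid2) : Prop :=
  forall h, h \in H <->
    exists s : seq 'X_{1..2}, [set` s] `<=` B /\ h = (\sum_(g <- s) g)%MM.

Definition is_Hilbert_basis (B : set 'X_{1..2}) (H : submonoid2) : Prop :=
  generates B H /\ forall B', B' `<=` B -> generates B' H -> B' = B.

(* The set x + H. *)
Definition translate (x : 'X_{1..2}) (H : submonoid2) : set 'X_{1..2} :=
  [set (x + h)%MM | h in [set` H]].

Definition lattice_pt (h : 'X_{1..2}) : 'rV[int]_2 := \row_i (h i)%:Z.

Section Cone.
Variable R : realType.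

Definition real_pt (z : 'rV[int]_2) : 'rV[R]_2 := map_mx intr z.

Definition cone (H : submonoid2) : set 'rV[R]_2 :=
  [set x | exists s : seq (R * 'X_{1..2}),
    (forall p, p \in s -> 0 <= p.1 /\ p.2 \in H)
    /\ x = \sum_(p <- s) p.1 *: real_pt (lattice_pt p.2)].

Definition affine_hull (C : set 'rV[R]_2) : set 'rV[R]_2 :=
  [set x | exists s : seq (R * 'rV[R]_2),
    [/\ forall p, p \in s -> C p.2, \sum_(p <- s) p.1 = 1
      & x = \sum_(p <- s) p.1 *: p.2]].

(* The interior of C in its affine hull, for the sup norm. *)
Definition relint (C : set 'rV[R]_2) : set 'rV[R]_2 :=
  [set x | affine_hull C x /\ exists2 e : R, 0 < e &
    forall y, affine_hull C y -> (forall i, `|y 0 i - x 0 i| < e) -> C y].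

(* F is the intersection of the cone C with a supporting hyperplane. *)
Definition is_face (C F : set 'rV[R]_2) : Prop :=
  exists u : 'cV[R]_2, (forall x, C x -> 0 <= (x *m u) 0 0)
    /\ F = C `&` [set x | (x *m u) 0 0 = 0].

(* H is finitely generated, generates Z^2 as a group, and H = cone H \cap Z^2. *)
Definition is_normal_affine2 (H : submonoid2) : Prop :=
  [/\ exists s : seq 'X_{1..2}, generates [set` s] H,
      forall z : 'rV[int]_2, exists g h,
        [/\ g \in H, h \in H & z = lattice_pt g - lattice_pt h]
    & forall z : 'rV[int]_2,
        cone H (real_pt z) <-> exists2 h, h \in H & z = lattice_pt h].

Definition is_extremal_ray (H : submonoid2) (a : 'X_{1..2}) : Prop :=
  [/\ a \in H, coprime (a ord0) (a ord_max)
    & is_face (cone H)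
        [set t *: real_pt (lattice_pt a) | t in [set t : R | 0 <= t]]].

(* As the cone lies in the nonnegative quadrant, all the points of Z^2 in its
   relative interior are in N^2. *)
Definition omega (H : submonoid2) : {pred 'X_{1..2}} :=
  [pred h | `[< relint (cone H) (real_pt (lattice_pt h)) >]].

Lemma lattice_ptD g h : lattice_pt (g + h)%MM = lattice_pt g + lattice_pt h.
Proof. by apply/rowP => i; rewrite !mxE mnmDE PoszD. Qed.

Lemma real_ptD y z : real_pt (y + z) = real_pt y + real_pt z.
Proof. exact: map_mxD. Qed.

Lemma coneD H x y : cone H x -> cone H y -> cone H (x + y).
Proof.
move=> [s [sP ->]] [t [tP ->]]; exists (s ++ t); rewrite big_cat; split=> // p.
by rewrite mem_cat => /orP[/sP|/tP].
Qed.

Lemma cone0 H : cone H 0.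
Proof. by exists [::]; rewrite big_nil; split. Qed.

Lemma cone_pt (H : submonoid2) h : h \in H -> cone H (real_pt (lattice_pt h)).
Proof.
move=> hH; exists [:: (1, h)]; rewrite big_seq1 scale1r; split=> // p.
by rewrite inE => /eqP ->.
Qed.

Lemma sub_affine_hull (C : set 'rV[R]_2) : C `<=` affine_hull C.
Proof.
move=> x Cx; exists [:: (1, x)]; rewrite !big_seq1 scale1r; split=> // p.
by rewrite inE => /eqP ->.
Qed.

Lemma affine_hullD (C : set 'rV[R]_2) x c a :
  C 0 -> affine_hull C x -> C c -> affine_hull C (x + a *: c).
Proof.
move=> C0 [s [sP s1 ->]] Cc; exists ((a, c) :: (- a, 0) :: s).
rewrite !big_cons /= s1 scaler0 add0r addrA subrr add0r; split=> //.
  by move=> p; rewrite !inE => /or3P[/eqP->|/eqP->|/sP].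
by rewrite addrC.
Qed.

Lemma omegaD (H : submonoid2) g h :
  g \in H -> h \in omega H -> (g + h)%MM \in omega H.
Proof.
move=> /cone_pt gC /asboolP[hA [e e0 he]]; apply/asboolP.
rewrite lattice_ptD real_ptD addrC.
set x := real_pt (lattice_pt h) in hA he *.
set c := real_pt (lattice_pt g) in gC *; split.
  by rewrite -(scale1r c); apply: affine_hullD => //; apply: cone0.
exists e => // y yA yx; rewrite -(subrK c y); apply: coneD => //; apply: he.
  by rewrite -scaleN1r; apply: affine_hullD => //; apply: cone0.
by move=> i; rewrite !mxE addrAC -addrA -opprD; have := yx i; rewrite !mxE.
Qed.

End Cone.

(** * The semigroup ring *)

Section SemigroupRing.
Variables (K : fieldType) (H : submonoid2).

(* The K-span of the monomials with exponent in H. *)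
Definition in_sgring : {pred {mpoly K[2]}} := [pred p | all (mem H) (msupp p)].

Lemma in_sgringP p : reflect {subset msupp p <= H} (p \in in_sgring).
Proof. exact: allP. Qed.

Lemma in_sgring_subalg : GRing.subalg_closed in_sgring.
Proof.
split=> [|a p q /in_sgringP pH /in_sgringP qH|p q /in_sgringP pH /in_sgringP qH].
- by apply/in_sgringP => m; rewrite msupp1 inE => /eqP ->; apply: submonoid2_0.
- apply/in_sgringP => m /msuppD_le; rewrite mem_cat => /orP[|/qH //].
  by move=> /msuppZ_le /pH.
apply/in_sgringP => m /msuppM_le /allpairsP[[m1 m2] /= [m1p m2q ->]].
by apply: submonoid2_D; [apply: pH | apply: qH].
Qed.

HB.instance Definition _ :=
  GRing.isSubalgClosed.Build K {mpoly K[2]} in_sgring in_sgring_subalg.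

Record sgring := SgRing { sgring_val : {mpoly K[2]}; _ : sgring_val \in in_sgring }.

HB.instance Definition _ := [isSub for sgring_val].
HB.instance Definition _ := [Choice of sgring by <:].
HB.instance Definition _ := [SubChoice_isSubComNzRing of sgring by <:].

(* The graded maximal ideal. *)
Definition sgring_max : set sgring :=
  ideal_gen [set r | exists h, [/\ h \in H, h <> 0%MM & val r = 'X_[h]]].

Variable R : realType.

Definition in_canon : {pred sgring^o} :=
  [pred r | all (mem (omega R H)) (msupp (val (r : sgring)))].

Lemma in_canonP (r : sgring) :
  reflect {subset msupp (val r) <= omega R H} (r \in in_canon).
Proof. exact: allP. Qed.

Lemma in_canon_submod : GRing.submod_closed in_canon.
Proof.
split=> [|a p q /in_canonP pO /in_canonP qO]; apply/in_canonP => m.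
  by rewrite msupp0.
move=> /msuppD_le; rewrite mem_cat => /orP[|/qO //].
move=> /msuppM_le /allpairsP[[m1 m2] /= [m1p m2q ->]].
by apply: omegaD (pO _ m2q); apply: (in_sgringP _ (valP (a : sgring))).
Qed.

HB.instance Definition _ :=
  GRing.isSubmodClosed.Build sgring sgring^o in_canon in_canon_submod.

(* The canonical module, as an ideal of K[H]. *)
Record canon_module := CanonModule { canon_module_val : sgring^o; _ : canon_module_val \in in_canon }.

HB.instance Definition _ := [isSub for canon_module_val].
HB.instance Definition _ := [Choice of canon_module by <:].
HB.instance Definition _ := [SubChoice_isSubZmodule of canon_module by <:].
HB.instance Definition _ := [SubZmodule_isSubLmodule of canon_module by <:].

Variable b : 'X_{1..2}.

(* The submodule x^b K[H], which lies in [canon_module] when b is in [omega]. *)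
Definition in_principal : {pred canon_module} :=
  [pred w | `[< exists r : sgring, val (val w : sgring) = 'X_[b] * val r >]].

Lemma in_principal_submod : GRing.submod_closed in_principal.
Proof.
split=> [|a v w /asboolP[r rE] /asboolP[s sE]]; apply/asboolP.
  by exists 0; rewrite /= mulr0.
exists ((a : sgring) * r + s).
rewrite /= in rE sE *; rewrite rE sE.
by rewrite mulrDr mulrCA.
Qed.

HB.instance Definition _ :=
  GRing.isSubmodClosed.Build sgring canon_module in_principal in_principal_submod.

Definition is_Ulrich_element : Prop :=
  b \in omega R H /\ is_Ulrich sgring_max (quotmod in_principal).

End SemigroupRing.

(* Main.v *)
From HB Require Import structures.
Require Import Defs.
From mathcomp Require Import all_boot all_order all_algebra.
From mathcomp Require Import zify ring lra.
From mathcomp Require Import mpoly.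
From mathcomp Require Import boolp classical_sets reals.

(** Let l1, l2 be the integral linear forms vanishing on a1, resp. a2, so that
    H = {l1, l2 >= 0} and omega_H = {l1, l2 > 0}. Since b is irreducible, no h in
    omega_H has both l1 h < l1 b and l2 h < l2 b; hence E = omega_R / x^b R has
    as K-basis the monomials of two disjoint strips {l1 < l1 b} and {l2 < l2 b}
    of omega_H, on which x^a1 + x^a2 acts as the translation by a1, resp. a2.
    The N exponents that are not translates of others form a basis of
    E / (x^a1 + x^a2) E. Far enough, m^(n+1) E is the translate of m^n E, so that
    the length of E / m^n E grows by N at each step: E has multiplicity N. By
    Nakayama's argument E is minimally generated by N elements iff
    m E = (x^a1 + x^a2) E, and this equality, tested on monomials, is the
    condition on the sums c1 + c2. *)

Set Implicit Arguments.
Unset Strict Implicit.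
Unset Printing Implicit Defensive.

Import Order.TTheory GRing.Theory Num.Theory.
Local Open Scope classical_set_scope.
Local Open Scope ring_scope.

(** Irreducibility of b, with b different from a1 and a2, also forces 0 < l_i b < D, as l1 b >= D
    would let a2 divide b. Hence translating the strip {l1 < l1 b} by a2 leads into b + H, and each
    ray acts on one strip only. Powers stabilize because [l1] is bounded on its strip: a long
    product must contain a factor with l1 = 0, and a1, being primitive, divides it.

    The Cohen-Macaulay property is the other obstacle: dimension and depth are maxima over all
    chains of primes and all regular sequences. One relation bounds both by 1. Since K[H] / x^b K[H]
    has linear growth, any x and y in K[H] satisfy a nontrivial polynomial relation over K modulo
    x^b, and such a relation kills E. Cancelling powers of x, then of y, from its lowest term would
    put 1 in the third prime of a chain, or make the ideal of a regular sequence generate all of E.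

    If omega_H = b + H, then E = 0 lies over no prime, has no dimension, and is treated apart. *)

Local Notation mon := 'X_{1..2}.
Local Notation span := Defs.span.

(** * Cone coordinates *)

(** The interface between convex geometry and combinatorics. [coords_le] is stated because
    subtraction of exponents is truncated; the two face fields carry the primitivity of a1 and a2;
    [coords_mdeg] turns bounded coordinates into finite sets and bounds growth in degree. *)
Record coords (R : realType) (H : submonoid2) (a1 a2 : mon)
    (l1 l2 : mon -> int) (D : int) : Prop := Coords {
  coord1D : forall g h, l1 (g + h)%MM = l1 g + l1 h;
  coord2D : forall g h, l2 (g + h)%MM = l2 g + l2 h;
  coord1_a1 : l1 a1 = 0;
  coord1_a2 : l1 a2 = D;
  coord2_a1 : l2 a1 = D;
  coord2_a2 : l2 a2 = 0;
  coord_gt0 : 0 < D;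
  mem_coords : forall h, (h \in H) = (0 <= l1 h) && (0 <= l2 h);
  omega_coords : forall h, (h \in omega R H) = (0 < l1 h) && (0 < l2 h);
  coords_le : forall g h, l1 g <= l1 h -> l2 g <= l2 h -> exists k, h = (g + k)%MM;
  coord1_face : forall h, h \in H -> l1 h = 0 -> 0 < l2 h -> D <= l2 h;
  coord2_face : forall h, h \in H -> l2 h = 0 -> 0 < l1 h -> D <= l1 h;
  coords_mdeg : exists M : int, forall h, h \in H ->
    [/\ l1 h <= M * (mdeg h)%:Z, l2 h <= M * (mdeg h)%:Z
      & (mdeg h)%:Z <= M * (l1 h + l2 h)]
}.

(** This symmetry lets every result on the strip of [l1] be reused on the strip of [l2]. *)
Lemma coords_swap R H a1 a2 l1 l2 D :
  coords R H a1 a2 l1 l2 D -> coords R H a2 a1 l2 l1 D.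
Proof.
case=> d1 d2 e11 e12 e21 e22 D0 mH mO le f1 f2 [M mM]; split=> //.
- by move=> h; rewrite mH andbC.
- by move=> h; rewrite mO andbC.
- by move=> g h ? ?; apply: le.
- by exists M => h /mM[? ? ?]; split; rewrite // addrC.
Qed.

Definition det2 (g h : mon) : int :=
  (g ord0)%:Z * (h ord_max)%:Z - (g ord_max)%:Z * (h ord0)%:Z.

Lemma det2D a g h : det2 a (g + h)%MM = det2 a g + det2 a h.
Proof. by rewrite /det2 !mnmDE !PoszD; ring. Qed.

Lemma ord2_cases (i : 'I_2) : i = ord0 \/ i = ord_max.
Proof. by case: i => [[|[|//]] ?]; [left|right]; apply: val_inj. Qed.

Lemma mon2P (g h : mon) : g ord0 = h ord0 -> g ord_max = h ord_max -> g = h.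
Proof.
move=> e0 e1; apply/mnmP => i.
by have [->|->] := ord2_cases i.
Qed.

Lemma det2_eq0 (a h : mon) : coprime (a ord0) (a ord_max) -> det2 a h = 0 ->
  exists k : nat, h = (a *+ k)%MM.
Proof.
rewrite /det2 => ca e.
have e' : (a ord0 * h ord_max = a ord_max * h ord0)%N by lia.
suff [k [k0 k1]] : exists k, h ord0 = (k * a ord0)%N /\ h ord_max = (k * a ord_max)%N.
  by exists k; apply: mon2P; rewrite mulmnE mulnC ?k0 ?k1 mulnC.
have [a0|a0] := posnP (a ord0).
  move: ca e'; rewrite a0 /coprime gcd0n => /eqP -> e'.
  by exists (h ord_max); lia.
have /dvdnP[k hk] : (a ord0 %| h ord0)%N.
  by rewrite -(Gauss_dvdr _ ca) -e' dvdn_mulr.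
exists k; split=> //; apply/eqP; rewrite -(eqn_pmul2l a0) e' hk; apply/eqP; lia.
Qed.

Lemma coprime_det2_neq0 (a1 a2 : mon) :
  coprime (a1 ord0) (a1 ord_max) -> coprime (a2 ord0) (a2 ord_max) ->
  a1 <> a2 -> det2 a1 a2 <> 0.
Proof.
move=> c1 c2 ne /(det2_eq0 c1) [k e]; apply: ne; rewrite e.
move: c2; rewrite e !mulmnE /coprime -muln_gcdl (eqP c1) mul1n => /eqP ->.
by rewrite mulm1n.
Qed.

(** * Determinants against the rays as cone coordinates *)

Section ConeCoordinates.
Variables (R : realType) (H : submonoid2).

Definition rdet2 (a : mon) (x : 'rV[R]_2) : R :=
  (a ord0)%:R * x 0 ord_max - (a ord_max)%:R * x 0 ord0.

Lemma rdet2_real (a h : mon) :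
  rdet2 a (real_pt R (lattice_pt h)) = (det2 a h)%:~R.
Proof. by rewrite /rdet2 /det2 !mxE rmorphB !rmorphM /=. Qed.

Lemma row2P (x y : 'rV[R]_2) :
  x 0 ord0 = y 0 ord0 -> x 0 ord_max = y 0 ord_max -> x = y.
Proof.
move=> e0 e1; apply/rowP => i.
by have [->|->] := ord2_cases i.
Qed.

Lemma lattice_pt_inj : injective lattice_pt.
Proof.
move=> g h /rowP e; apply/mnmP => i; have := e i; rewrite !mxE.
by case.
Qed.

(** In the plane, the functional cutting out the ray of a vanishes at a, so it is proportional to
    the determinant against a. Its sign on the cone therefore fixes the sign of that determinant,
    which is read off at a point a' outside the ray. *)
Lemma supporting_det2_ge0 (a a' h : mon) :
  is_extremal_ray R H a -> a' \in H -> h \in H ->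
  det2 a a' != 0 -> 0 <= det2 a a' * det2 a h.
Proof.
case=> aH _ [u [uC uF]] a'H hH d0.
pose pt (g : mon) := real_pt R (lattice_pt g).
pose phi (x : 'rV[R]_2) := x 0 ord0 * u ord0 0 + x 0 ord_max * u ord_max 0.
have phiE x : (x *m u) 0 0 = phi x.
  rewrite mxE big_ord_recl big_ord1.
  by congr (_ + x 0 _ * u _ 0); apply: val_inj.
have ptC g : g \in H -> cone H (pt g) := fun gH => cone_pt R gH.
have phi1 : phi (pt a) = 0.
  have : [set t *: pt a | t in [set t : R | 0 <= t]] (pt a).
    by exists 1; rewrite /= ?scale1r.
  by rewrite uF => -[_ /=]; rewrite phiE.
have phi_ge0 g : g \in H -> 0 <= phi (pt g).
  by move=> gH; rewrite -phiE; apply/uC/ptC.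
have phi2 : 0 < phi (pt a').
  rewrite lt_neqAle phi_ge0 // andbT; apply/eqP => e.
  have : (cone H `&` [set x | (x *m u) 0 0 = 0]) (pt a').
    by split; [apply: ptC | rewrite /= phiE].
  rewrite -uF => -[t _ te]; move: d0; rewrite -(intr_eq0 R) -rdet2_real -/(pt a') -te.
  by rewrite /rdet2 !mxE -!pmulrn; apply/negP; rewrite negbK; apply/eqP; ring.
(* The proportionality, free of division: after multiplication by a nonzero coordinate of a, the
   difference of the two sides is a multiple of phi (pt a) = 0. *)
have key : rdet2 a (pt h) * phi (pt a') = rdet2 a (pt a') * phi (pt h).
  have : (a ord0)%:R != 0 :> R \/ (a ord_max)%:R != 0 :> R.
    apply/orP; rewrite -negb_and; apply/negP => /andP[/eqP p0 /eqP q0].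
    by move: d0; rewrite -(intr_eq0 R) -rdet2_real /rdet2 p0 q0 !mul0r subrr eqxx.
  move: phi1; rewrite /phi /rdet2 !mxE -!pmulrn => e1.
  move: e1; move: (a ord0)%:R (a ord_max)%:R (u ord0 0) (u ord_max 0) => p q u0 u1 e1.
  move: (a' ord0)%:R (a' ord_max)%:R (h ord0)%:R (h ord_max)%:R => p' q' x y.
  case=> /mulfI; apply; apply/eqP; rewrite -subr_eq0; apply/eqP.
  - transitivity ((p * u0 + q * u1) * ((p * y - q * x) * p' - (p * q' - q * p') * x)).
      ring.
    by rewrite e1 mul0r.
  - transitivity ((p * u0 + q * u1) * ((p * y - q * x) * q' - (p * q' - q * p') * y)).
      ring.
    by rewrite e1 mul0r.
rewrite -(ler0z R) rmorphM /= -!rdet2_real -(pmulr_lge0 _ phi2) -mulrA key mulrA.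
by rewrite -expr2 mulr_ge0 ?sqr_ge0 ?phi_ge0.
Qed.

Variables a1 a2 : mon.
Hypotheses (Hnormal : is_normal_affine2 R H) (a1R : is_extremal_ray R H a1)
  (a2R : is_extremal_ray R H a2) (d0 : 0 < det2 a1 a2).

Let D := det2 a1 a2.
Let L1 := rdet2 a1.
Let L2 (x : 'rV[R]_2) := - rdet2 a2 x.
Let pt (g : mon) := real_pt R (lattice_pt g).
Let l1 := det2 a1.
Let l2 h := - det2 a2 h.

Let det2_anti g h : det2 g h = - det2 h g.
Proof. by rewrite /det2; ring. Qed.

Let det2_self g : det2 g g = 0.
Proof. by rewrite /det2; ring. Qed.

Let D0 : 0 < D%:~R :> R. Proof. by rewrite ltr0z. Qed.

Let DE : D%:~R =
  (a1 ord0)%:R * (a2 ord_max)%:R - (a1 ord_max)%:R * (a2 ord0)%:R :> R.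
Proof. by rewrite /D /det2 rmorphB !rmorphM. Qed.

Let L1pt h : L1 (pt h) = (l1 h)%:~R. Proof. exact: rdet2_real. Qed.

Let L2pt h : L2 (pt h) = (l2 h)%:~R.
Proof. by rewrite /L2 rdet2_real rmorphN. Qed.

(** Cramer's rule in the basis a1, a2. *)
Let decompose (x : 'rV[R]_2) :
  x = (L2 x / D%:~R) *: pt a1 + (L1 x / D%:~R) *: pt a2.
Proof.
have Dn : D%:~R != 0 :> R by rewrite gt_eqF.
apply: (scalerI Dn); rewrite scalerDr !scalerA !(mulrC D%:~R) !divfK //.
by apply: row2P; rewrite !mxE /L1 /L2 /rdet2 DE -!pmulrn; ring.
Qed.

Let a1H : a1 \in H. Proof. by case: a1R. Qed.
Let a2H : a2 \in H. Proof. by case: a2R. Qed.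

Let l1_ge0 h : h \in H -> 0 <= l1 h.
Proof.
move=> hH; have := supporting_det2_ge0 a1R a2H hH; rewrite gt_eqF // => /(_ isT).
by rewrite pmulr_rge0.
Qed.

Let l2_ge0 h : h \in H -> 0 <= l2 h.
Proof.
move=> hH; have := supporting_det2_ge0 a2R a1H hH.
by rewrite det2_anti oppr_eq0 gt_eqF // mulNr -mulrN pmulr_rge0 // => /(_ isT).
Qed.

Let L1_linear : linear (L1 : _ -> R^o).
Proof. by move=> k x y; rewrite /L1 /rdet2 !mxE /= /GRing.scale /=; ring. Qed.

Let L2_linear : linear (L2 : _ -> R^o).
Proof. by move=> k x y; rewrite /L2 /rdet2 !mxE /= /GRing.scale /=; ring. Qed.

HB.instance Definition _ := GRing.isLinear.Build R _ R^o _ L1 L1_linear.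
HB.instance Definition _ := GRing.isLinear.Build R _ R^o _ L2 L2_linear.

Let cone_L x : cone H x <-> 0 <= L1 x /\ 0 <= L2 x.
Proof.
split=> [[s [sP ->]]|[x1 x2]].
  by rewrite !linear_sum /=; split; rewrite big_seq; apply: sumr_ge0 => p /sP[p0 pH];
    rewrite linearZ /= mulr_ge0 // ?L1pt ?L2pt ler0z ?l1_ge0 ?l2_ge0.
exists [:: (L2 x / D%:~R, a1); (L1 x / D%:~R, a2)]; split; last first.
  by rewrite big_cons big_seq1; apply: decompose.
by move=> p; rewrite !inE => /orP[]/eqP -> /=; rewrite divr_ge0 // ltW.
Qed.

Let affine_full x : affine_hull (cone (R := R) H) x.
Proof.
rewrite (decompose x) -[_ *: pt a1]add0r.
have C0 : cone (R := R) H 0 by apply: cone0.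
apply: affine_hullD (cone_pt R a2H) => //.
by apply: affine_hullD (cone_pt R a1H) => //; apply: sub_affine_hull.
Qed.

(** The affine hull is the whole plane. From an interior point one may still step back along a1 and
    a2, which lowers [L2] and [L1]; conversely these forms are Lipschitz for the sup norm. *)
Let relint_L x : relint (cone H) x <-> 0 < L1 x /\ 0 < L2 x.
Proof.
(* [m a] bounds both the Lipschitz constant of [rdet2 a] and the sup norm of a; the 1 makes the
   bounds strict. *)
pose m (a : mon) : R := (a ord0)%:R + (a ord_max)%:R + 1.
have m0 a : 0 < m a by rewrite ltr_wpDl ?addr_ge0.
have shift a (y : 'rV[R]_2) e : (forall i, `|y 0 i - x 0 i| < e) ->
    `|rdet2 a y - rdet2 a x| < m a * e.
  move=> yx; have -> : rdet2 a y - rdet2 a x =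
    (a ord0)%:R * (y 0 ord_max - x 0 ord_max) + (a ord_max)%:R * - (y 0 ord0 - x 0 ord0).
    by rewrite /rdet2; ring.
  apply: le_lt_trans (ler_normD _ _) _; rewrite !normrM normrN !normr_nat.
  have e0 : 0 < e by apply: le_lt_trans (yx ord0).
  apply: (@le_lt_trans _ _ ((a ord0)%:R * e + (a ord_max)%:R * e)).
    by rewrite lerD // ler_wpM2l // ltW.
  by rewrite /m !mulrDl mul1r ltrDl.
have mi a i : `|(pt a) 0 i| < m a.
  rewrite !mxE -pmulrn normr_nat /m.
  have [->|->] := ord2_cases i.
    by rewrite -addrA ltrDl ltr_wpDl.
  by rewrite addrAC ltrDr ltr_wpDl.
split=> [[_ [e e0 xe]]|[x1 x2]].
  have step a : cone H (x - (e / m a) *: pt a).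
    apply: xe => // i.
    have -> : (x - (e / m a) *: pt a) 0 i - x 0 i = - (e / m a * pt a 0 i).
      by rewrite !mxE; ring.
    have em0 : 0 < e / m a by rewrite divr_gt0.
    rewrite normrN normrM (gtr0_norm em0) -ltr_pdivlMl // invf_div divfK; first exact: mi.
    by rewrite gt_eqF.
  have [/cone_L[y1 _] /cone_L[_ y2]] := (step a2, step a1).
  move: y1 y2; rewrite !linearB !linearZ /= !subr_ge0 L1pt L2pt /l1 /l2.
  rewrite (det2_anti a2 a1) opprK => y1 y2.
  by split; [apply: lt_le_trans y1 | apply: lt_le_trans y2];
    apply: mulr_gt0 => //; apply: divr_gt0.
split=> //.
exists (Num.min (L1 x / m a1) (L2 x / m a2)).
  by rewrite lt_min !divr_gt0.
move=> y _ yx; apply/cone_L.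
have := shift a1 y _ yx; have := shift a2 y _ yx.
rewrite !ltr_norml => /andP[_ s2] /andP[s1 _].
have t1 : m a1 * Num.min (L1 x / m a1) (L2 x / m a2) <= L1 x.
  by rewrite mulrC -ler_pdivlMr // ge_min lexx.
have t2 : m a2 * Num.min (L1 x / m a1) (L2 x / m a2) <= L2 x.
  by rewrite mulrC -ler_pdivlMr // ge_min lexx orbT.
by rewrite /L1 /L2 in t1 t2 *; split; lra.
Qed.

Let mem_l h : (h \in H) = (0 <= l1 h) && (0 <= l2 h).
Proof.
apply/idP/andP => [hH|[h1 h2]]; first by rewrite l1_ge0 ?l2_ge0.
case: Hnormal => _ _ /(_ (lattice_pt h))[+ _]; case.
  by apply/cone_L; rewrite L1pt L2pt !ler0z.
by move=> g gH /lattice_pt_inj ->.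
Qed.

Let Dcoord0 (h : mon) : D * (h ord0)%:Z = l2 h * (a1 ord0)%:Z + l1 h * (a2 ord0)%:Z.
Proof. by rewrite /D /l1 /l2 /det2; ring. Qed.
Let Dcoord1 (h : mon) : D * (h ord_max)%:Z = l2 h * (a1 ord_max)%:Z + l1 h * (a2 ord_max)%:Z.
Proof. by rewrite /D /l1 /l2 /det2; ring. Qed.

(** The truncated difference is a true one: by Cramer's rule D (h - g) is a nonnegative combination
    of a1 and a2, whose entries are natural numbers. *)
Let le_l (g h : mon) : l1 g <= l1 h -> l2 g <= l2 h -> exists k, h = (g + k)%MM.
Proof.
move=> le1 le2; exists (h - g)%MM; rewrite addmC submK //; apply/mnm_lepP => i.
have [->|->] := ord2_cases i.
- rewrite -lez_nat -(ler_pM2l (x := D)) // !Dcoord0; nia.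
- rewrite -lez_nat -(ler_pM2l (x := D)) // !Dcoord1; nia.
Qed.

Let face_l (a h : mon) (l : mon -> int) (E : int) :
  coprime (a ord0) (a ord_max) -> det2 a h = 0 -> 0 < E ->
  (forall k, l (a *+ k)%MM = k%:Z * E) -> 0 < l h -> E <= l h.
Proof.
move=> ca /(det2_eq0 ca)[k ->] E0 ->; case: k => [|k] k0; first by rewrite mul0r in k0.
by rewrite ler_peMl // ltW.
Qed.

Let mdeg2 (h : mon) : (mdeg h)%:Z = (h ord0)%:Z + (h ord_max)%:Z.
Proof.
rewrite mdegE big_ord_recl big_ord1 PoszD.
by congr (_ + Posz (h _)); apply: val_inj.
Qed.

Lemma coords_det2 : coords R H a1 a2 l1 l2 D.
Proof.
have D0' : 0 < D := d0.
split=> //.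
- by move=> g h; rewrite /l1 det2D.
- by move=> g h; rewrite /l2 det2D opprD.
- exact: det2_self.
- by rewrite /l2 -det2_anti.
- by rewrite /l2 det2_self oppr0.
- move=> h; apply/asboolP/andP.
    by move=> /relint_L; rewrite -/(pt h) L1pt L2pt !ltr0z.
  by move=> ?; apply/relint_L; rewrite -/(pt h) L1pt L2pt !ltr0z.
- move=> h _ h0; apply: (@face_l a1 h l2) => //; first by case: a1R.
  by move=> k; rewrite /l2 /D /det2 !mulmnE !PoszM; ring.
- move=> h _ /eqP; rewrite oppr_eq0 => /eqP h0.
  apply: (@face_l a2 h l1) => //; first by case: a2R.
  by move=> k; rewrite /l1 /D /det2 !mulmnE !PoszM; ring.
(* This number bounds every entry of a1 and a2, hence the coefficients of [l1] and [l2]; for the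
   third bound, Cramer's rule is used with D >= 1. *)
exists (mdeg a1 + mdeg a2)%:Z => h; rewrite mem_l => /andP[h1 h2].
have := Dcoord0 h; have := Dcoord1 h.
rewrite PoszD !mdeg2; move: h1 h2; rewrite /l1 /l2 /det2.
move: (a1 ord0) (a1 ord_max) (a2 ord0) (a2 ord_max) (h ord0) (h ord_max).
move=> p q p' q' x y h1 h2 e1 e0.
split; nia.

Qed.

End ConeCoordinates.

Lemma coords_exist (R : realType) (H : submonoid2) (a1 a2 : mon) :
  is_normal_affine2 R H -> is_extremal_ray R H a1 -> is_extremal_ray R H a2 ->
  a1 <> a2 -> exists l1 l2 D, coords R H a1 a2 l1 l2 D.
Proof.
move=> nH r1 r2 ne.
have /eqP : det2 a1 a2 <> 0 by apply: coprime_det2_neq0 => //; [case: r1|case: r2].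
rewrite neq_lt => /orP[lt0|gt0].
  have gt0 : 0 < det2 a2 a1 by move: lt0; rewrite /det2; lia.
  by do 3!eexists; apply/coords_swap/(coords_det2 nH r2 r1 gt0).
by do 3!eexists; apply: (coords_det2 nH r1 r2 gt0).
Qed.

(** * Modules over commutative rings *)

Lemma left_kernel_neq0 (K : fieldType) (k l : nat) (M : 'M[K]_(k, l)) :
  (l < k)%N -> exists2 c : 'rV_k, c != 0 & c *m M = 0.
Proof.
move=> lk; have : kermx M != 0.
  by rewrite -mxrank_eq0 mxrank_ker subn_eq0 -ltnNge (leq_ltn_trans (rank_leq_col M)).
case/rowV0Pn => c /sub_kermxP cM c0.
by exists c.
Qed.

Lemma is_max_unique S m n : is_max S m -> is_max S n -> m = n.
Proof.
by move=> [mS mM] [nS nM]; apply/eqP; rewrite eqn_leq mM ?nM.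
Qed.

Section Submodules.
Variables (A : comNzRingType) (M : lmodType A).
Implicit Types (N : set M) (S : set M) (u v w : M).

Lemma submoduleB N u v : is_submodule N -> N u -> N v -> N (u - v).
Proof.
by case=> _ nD nZ uN vN; apply: nD => //; rewrite -scaleN1r; apply: nZ.
Qed.

Lemma submodule_sum N (I : eqType) (s : seq I) (F : I -> M) :
  is_submodule N -> (forall i, i \in s -> N (F i)) -> N (\sum_(i <- s) F i).
Proof.
case=> n0 nD _; elim: s => [|i s IH] sF; first by rewrite big_nil.
rewrite big_cons; apply: nD; first by apply: sF; rewrite mem_head.
by apply: IH => j js; apply: sF; rewrite inE js orbT.
Qed.

Lemma span_submodule S : is_submodule (span S).
Proof.
split=> [|u v [s [sS ->]] [t [tS ->]]|a v [s [sS ->]]].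
- by exists [::]; rewrite big_nil.
- exists (s ++ t); rewrite big_cat; split=> // p.
  by rewrite mem_cat => /orP[/sS|/tS].
exists [seq (a * p.1, p.2) | p <- s]; split; first by move=> _ /mapP[p /sS ? ->].
by rewrite big_map scaler_sumr; apply: eq_bigr => p _; rewrite scalerA.
Qed.

Lemma mem_gens_span S : S `<=` span S.
Proof.
move=> v Sv; exists [:: (1, v)]; rewrite big_seq1 scale1r; split=> // p.
by rewrite inE => /eqP ->.
Qed.

Lemma span_min S N : is_submodule N -> S `<=` N -> span S `<=` N.
Proof.
move=> nN SN _ [s [sS ->]]; apply: submodule_sum => // p /sS /SN Np.
by case: nN => _ _; apply.
Qed.

(* Lowest-order term of a relation in powers of a nonzerodivisor x modulo N. *)
Lemma lowest_term N x n k (F : nat -> M) : is_submodule N ->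
  (forall u, N (x *: u) -> N u) -> N (\sum_(i < n) x ^+ i *: F i) ->
  (k < n)%N -> (forall i, (i < k)%N -> F i = 0) -> exists u, N (F k + x *: u).
Proof.
move=> nN xN; elim: k n F => [|k IH] [//|n] F; rewrite big_ord_recl expr0 scale1r.
  rewrite (eq_bigr (fun i : 'I_n => x *: (x ^+ i *: F i.+1))) => [|i _].
    by rewrite -scaler_sumr; eexists; eassumption.
  by rewrite exprS scalerA.
move=> + kn F0; rewrite (F0 0%N) // add0r => NF.
apply: (IH n (fun i => F i.+1)) => // [|i ik]; last exact: F0.
apply: xN; rewrite scaler_sumr; move: NF; congr (N _).
by apply: eq_bigr => i _; rewrite exprS scalerA.
Qed.

(** Let (k, j) be the lexicographically least index with a nonzero coefficient. Cancelling x^k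
    modulo N0 puts the coefficient of x^k in N1, which contains x M; cancelling y^j modulo N1 then
    puts c_kj v in N2, and c_kj is a unit. The form covers both a chain of three primes, with v = 1,
    and a regular sequence of length at least two. *)
Lemma regular_pair_relation (N0 N1 N2 : set M) (x y : A) v n (c : nat -> nat -> A) :
  is_submodule N0 -> is_submodule N1 -> is_submodule N2 ->
  N0 `<=` N1 -> N1 `<=` N2 ->
  (forall u, N0 (x *: u) -> N0 u) -> (forall u, N1 (x *: u)) ->
  (forall u, N1 (y *: u) -> N1 u) -> (forall u, N2 (y *: u)) ->
  (forall i j, c i j = 0 \/ exists d, d * c i j = 1) ->
  (exists i j, [/\ (i < n)%N, (j < n)%N & c i j != 0]) ->
  N0 (\sum_(i < n) \sum_(j < n) (x ^+ i * y ^+ j * c i j) *: v) -> N2 v.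
Proof.
move=> n0 n1 n2 N01 N12 xN0 xN1 yN1 yN2 cU cN0 Nsum.
pose F i := \sum_(j < n) y ^+ j *: (c i j *: v).
pose P k := (k < n)%N && [exists j : 'I_n, c k j != 0].
have exP : exists k, P k.
  case: cN0 => i [j [ilt jlt cij]]; exists i; rewrite /P ilt /=.
  by apply/existsP; exists (Ordinal jlt).
case: (ex_minnP exP) => k /andP[kn /existsP[j0 cj0]] kmin.
have NsumF : N0 (\sum_(i < n) x ^+ i *: F i).
  move: Nsum; congr (N0 _); apply: eq_bigr => i _; rewrite scaler_sumr.
  by apply: eq_bigr => j _; rewrite !scalerA.
have [i ik|u Nu] := lowest_term n0 xN0 NsumF kn.
  rewrite /F big1 // => j _.
  have : ~~ P i by apply/negP => /kmin; rewrite leqNgt ik.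
  rewrite /P (ltn_trans ik kn) negb_exists => /forallP/(_ j).
  by rewrite negbK => /eqP ->; rewrite scale0r scaler0.
have {Nu} NF : N1 (F k).
  by rewrite -[F k](addrK (x *: u)); apply: submoduleB => //; apply: N01.
have exQ : exists j, (j < n)%N && (c k j != 0) by exists j0; rewrite ltn_ord.
case: (ex_minnP exQ) => j /andP[jn cj] jmin.
have [|w Nw] := @lowest_term N1 y n j (fun j => c k j *: v) n1 yN1 NF jn.
  move=> i ij; have [->|ci] := eqVneq (c k i) 0; first by rewrite scale0r.
  by move: (jmin i); rewrite ci (ltn_trans ij jn) leqNgt ij => /(_ isT).
have {Nw} : N2 (c k j *: v).
  by rewrite -[_ *: v](addrK (y *: w)); apply: submoduleB => //; apply: N12.
case: (cU k j) => [c0|[d dc]]; first by rewrite c0 eqxx in cj.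
by case: n2 => _ _ nZ /(nZ d); rewrite scalerA dc scale1r.
Qed.

End Submodules.

(** * The module omega / x^b K[H] in coordinates *)

Section MonomialCoefficients.
Variables (n : nat) (K : fieldType).
Implicit Types (p q : {mpoly K[n]}) (g h : 'X_{1..n}).

Lemma mcoeffM_neq0 p q h : (p * q)@_h != 0 ->
  exists g k, [/\ h = (g + k)%MM, p@_g != 0 & q@_k != 0].
Proof.
rewrite -mcoeff_msupp => /msuppM_le /allpairsP[[g k] /= [gp kq ->]].
by exists g, k; rewrite -!mcoeff_msupp.
Qed.

Lemma mcoeffXM p g h : ('X_[g] * p)@_(g + h)%MM = p@_h.
Proof. by rewrite mulrC mcoeffMX. Qed.

Lemma mcoeffXM_neq0 p g h : ('X_[g] * p)@_h != 0 ->
  exists2 k, h = (g + k)%MM & p@_k != 0.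
Proof.
case/mcoeffM_neq0 => g' [k [-> + pk]]; rewrite mcoeffX.
by have [->|//] := eqVneq g g'; [exists k|rewrite eqxx].
Qed.

(** The no-cancellation principle behind three arguments: constant terms, lowest terms along a face,
    and coefficients at exponents outside m E. *)
Lemma mcoeffM_at p q g h :
  (forall g' h', (g + h)%MM = (g' + h')%MM -> p@_g' != 0 -> q@_h' != 0 -> g' = g) ->
  (p * q)@_(g + h)%MM = p@_g * q@_h.
Proof.
move=> uniq_gh; pose p' := p - p@_g *: 'X_[g].
have -> : p = p@_g *: 'X_[g] + p' by rewrite addrC subrK.
have p'E k : p'@_k = (if k == g then 0 else p@_k).
  rewrite mcoeffB mcoeffZ mcoeffX; have [->|] := eqVneq k g.
    by rewrite mulr1 subrr.
  by rewrite mulr0 subr0.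
rewrite mulrDl mcoeffD -scalerAl mcoeffZ mcoeffXM mcoeffD p'E eqxx addr0 mcoeffZ mcoeffX.
rewrite eqxx mulr1 (_ : (p' * q)@_ _ = 0) ?addr0 //; apply/eqP.
apply: contraT => /mcoeffM_neq0[g' [k [e + qk]]]; rewrite p'E.
have [_|ne pg] := eqVneq g' g; first by rewrite eqxx.
by rewrite (uniq_gh _ _ e pg qk) eqxx in ne.
Qed.

End MonomialCoefficients.

(** * Coefficients of the elements of E *)

Section SemigroupModule.
Variables (K : fieldType) (H : submonoid2) (R : realType) (b : mon).
Hypothesis omegaH : {subset omega R H <= H}.

Let A := sgring K H.
Let W := canon_module K H R.
Let E := quotmod (in_principal (K := K) (H := H) (R := R) b).

Implicit Types (r s : sgring K H) (g h k c : mon).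

(** The default 0 is returned when p lies outside K[H]. *)
Definition sgpoly (p : {mpoly K[2]}) : sgring K H := insubd 0 p.

Lemma val_sgpoly p : {subset msupp p <= H} -> val (sgpoly p) = p.
Proof. by move=> pH; apply: insubdK; apply/in_sgringP. Qed.

Lemma sgring_supp r h : (val r)@_h != 0 -> h \in H.
Proof. by rewrite -mcoeff_msupp; move/in_sgringP: (valP r); apply. Qed.

Lemma val_sgD r s : val (r + s) = val r + val s. Proof. exact: rmorphD. Qed.
Lemma val_sgM r s : val (r * s) = val r * val s. Proof. exact: rmorphM. Qed.
Lemma val_sg0 : val (0 : sgring K H) = 0. Proof. exact: rmorph0. Qed.
Lemma val_sg1 : val (1 : sgring K H) = 1. Proof. exact: rmorph1. Qed.

Lemma val_sg_sum (I : Type) (t : seq I) (F : I -> sgring K H) :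
  val (\sum_(i <- t) F i) = \sum_(i <- t) val (F i).
Proof. exact: raddf_sum. Qed.

Definition sgX h : sgring K H := sgpoly 'X_[h].
Definition sgC (a : K) : sgring K H := sgpoly a%:MP.

Lemma val_sgX h : h \in H -> val (sgX h) = 'X_[h].
Proof.
by move=> hH; rewrite val_sgpoly // => m; rewrite msuppX inE => /eqP ->.
Qed.

Lemma val_sgC a : val (sgC a) = a%:MP.
Proof.
rewrite val_sgpoly // => m; rewrite msuppC; case: ifP => // _.
by rewrite inE => /eqP ->; apply: submonoid2_0.
Qed.

Lemma sgC0 : sgC 0 = 0.
Proof. by apply: val_inj; rewrite val_sgC val_sg0 mpolyC0. Qed.

Lemma sgC_inv a : a != 0 -> sgC a^-1 * sgC a = 1.
Proof.
by move=> a0; apply: val_inj; rewrite val_sgM val_sg1 !val_sgC -mpolyCM mulVf ?mpolyC1.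
Qed.

Lemma mcoeff_sgCM a r h : (val (sgC a * r))@_h = a * (val r)@_h.
Proof. by rewrite val_sgM val_sgC mcoeffCM. Qed.

Lemma mcoeff0_sgM r s : (val (r * s))@_0%MM = (val r)@_0%MM * (val s)@_0%MM.
Proof.
rewrite val_sgM -{1}(addm0 0%MM); apply: mcoeffM_at => g h /esym/eqP.
by rewrite addm0 mnmD_eq0 => /andP[/eqP].
Qed.

Lemma sgring_maxP r : sgring_max r <-> (val r)@_0%MM = 0.
Proof.
split=> [|r0].
  pose N : set A^o := [set s : A | (val s)@_0%MM = 0].
  apply: (@span_min _ _ _ N) => [|s [h [hH h0 sE]]].
    split=> [|s t s0 t0|a s s0].
    - by change ((val (0 : A))@_0%MM = 0); rewrite val_sg0 mcoeff0.
    - change ((val ((s : A) + t))@_0%MM = 0).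
      by rewrite val_sgD mcoeffD [_@__]s0 [_@__]t0 addr0.
    - by change ((val ((a : A) * s))@_0%MM = 0); rewrite mcoeff0_sgM [X in _ * X]s0 mulr0.
  by rewrite /N /= sE mcoeffX; case: eqP.
exists [seq (sgC (val r)@_h, sgX h) | h <- msupp (val r)]; split.
  move=> _ /mapP[h hr ->] /=.
  have hH : h \in H by apply: (sgring_supp (r := r)); rewrite -mcoeff_msupp.
  exists h; split; rewrite ?val_sgX // => h0.
  by move: hr; rewrite mcoeff_msupp h0 r0 eqxx.
apply: val_inj; rewrite big_map val_sg_sum; apply: (etrans (mpolyE _)).
apply: eq_big_seq => h hr; rewrite -[RHS]/(val (sgC (val r)@_h * sgX h)).
have hH : h \in H by apply: (sgring_supp (r := r)); rewrite -mcoeff_msupp.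
by rewrite val_sgM val_sgC val_sgX // mul_mpolyC.
Qed.

(* The exponents of the monomial basis of omega / x^b K[H]. *)
Definition res_mon h : bool := (h \in omega R H) && ~~ `[< translate b H h >].

Lemma divisible_by_Xb (p : {mpoly K[2]}) :
  (forall h, ~ translate b H h -> p@_h = 0) -> exists r, p = 'X_[b] * val r.
Proof.
move=> pb; have pbP h : h \in msupp p -> exists2 k, k \in H & h = (b + k)%MM.
  move=> hp; have : translate b H h.
    apply: contrapT => /pb e; by rewrite mcoeff_msupp e eqxx in hp.
  by case=> k kH <-; exists k.
exists (sgpoly (\sum_(h <- msupp p) p@_h *: 'X_[h - b])).
rewrite val_sgpoly => [|m].
  rewrite {1}[p]mpolyE mulr_sumr; apply: eq_big_seq => h /pbP[k _ ->].
  by rewrite -scalerAr -mpolyXD [(b + k)%MM]addmC addmK addmC.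
move=> /msupp_sum_le /flatten_mapP[h hp]; rewrite filter_predT in hp.
move=> /msuppZ_le; rewrite msuppX inE => /eqP ->.
by case/pbP: hp => k kH ->; rewrite addmC addmK.
Qed.

Definition cval (w : W) : {mpoly K[2]} := val (val w : A).

Lemma cval_supp w h : (cval w)@_h != 0 -> h \in omega R H.
Proof. by rewrite -mcoeff_msupp; move/in_canonP: (valP w); apply. Qed.

Lemma cvalD (v w : W) : cval (v + w) = cval v + cval w. Proof. by []. Qed.
Lemma cvalB (v w : W) : cval (v - w) = cval v - cval w. Proof. by []. Qed.
Lemma cvalZ (a : A) (w : W) : cval (a *: w) = val a * cval w. Proof. by []. Qed.

Lemma in_principalP (w : W) :
  reflect (forall h, res_mon h -> (cval w)@_h = 0) (w \in in_principal b).
Proof.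
apply: (iffP (asboolP _)) => [[r wE] h|w0].
  case/andP=> _ /asboolP hb; rewrite /cval wE; apply/eqP; apply: contraT.
  move=> /mcoeffXM_neq0[k hE /sgring_supp kH].
  by case: hb; exists k.
apply: divisible_by_Xb => h hb; apply/eqP; apply: contraT => wh.
have /w0 e : res_mon h by rewrite /res_mon (cval_supp wh); apply/asboolPn.
by rewrite e eqxx in wh.
Qed.

(** Outside [res_mon] this value depends on the representative picked by [repr]; it is an invariant
    of v only at residual exponents, which is why they are required throughout. *)
Definition rcoef (v : E) h : K := (cval (repr v))@_h.

Lemma rcoef_pi (w : W) h :
  res_mon h -> rcoef (quotmod_pi (in_principal b) w) h = (cval w)@_h.
Proof.
move=> hS; apply/eqP; rewrite -subr_eq0 -mcoeffB -cvalB; apply/eqP.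
have : repr (quotmod_pi (in_principal b) w) - w \in (in_principal b : {pred W}).
  by apply/quotmod_piP; rewrite quotmod_reprK.
by move/in_principalP; apply.
Qed.

Lemma rcoefP (u v : E) : (forall h, res_mon h -> rcoef u h = rcoef v h) -> u = v.
Proof.
move=> uv; rewrite -(quotmod_reprK u) -(quotmod_reprK v); apply/quotmod_piP.
by apply/in_principalP => h hS; rewrite cvalB mcoeffB; apply/eqP; rewrite subr_eq0; apply/eqP/uv.
Qed.

Lemma rcoefD (u v : E) h : res_mon h -> rcoef (u + v) h = rcoef u h + rcoef v h.
Proof.
move=> hS; rewrite -{1}(quotmod_reprK u) -{1}(quotmod_reprK v) -quotmod_piD.
by rewrite rcoef_pi // cvalD mcoeffD.
Qed.

Lemma rcoef0 h : res_mon h -> rcoef 0 h = 0.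
Proof. by move=> hS; apply: (addrI (rcoef 0 h)); rewrite -rcoefD // !addr0. Qed.

Lemma rcoefZ (a : A) (v : E) h :
  res_mon h -> rcoef (a *: v) h = (val a * cval (repr v))@_h.
Proof.
move=> hS; rewrite -{1}(quotmod_reprK v) -[_ *: _]/(quotmod_scale _ _) quotmod_scale_pi.
by rewrite rcoef_pi // cvalZ.
Qed.

Lemma rcoefZC a (v : E) h : res_mon h -> rcoef (sgC a *: v) h = a * rcoef v h.
Proof. by move=> hS; rewrite rcoefZ // val_sgC mcoeffCM. Qed.

Lemma rcoef_sum (I : Type) (s : seq I) (F : I -> E) h : res_mon h ->
  rcoef (\sum_(i <- s) F i) h = \sum_(i <- s) rcoef (F i) h.
Proof.
move=> hS; elim: s => [|i s IH]; first by rewrite !big_nil rcoef0.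
by rewrite !big_cons rcoefD // IH.
Qed.

Definition resX h : E := quotmod_pi (in_principal b) (insubd 0 (sgX h : A^o)).

Lemma cval_sgX m : m \in omega R H -> cval (insubd 0 (sgX m : A^o) : W) = 'X_[m].
Proof.
move=> mO; rewrite /cval insubdK; first by rewrite val_sgX ?omegaH.
by apply/in_canonP => m'; rewrite val_sgX ?omegaH // msuppX inE => /eqP ->.
Qed.

Lemma rcoef_resX g h : g \in omega R H -> res_mon h -> rcoef (resX g) h = (g == h)%:R.
Proof. by move=> gO hS; rewrite rcoef_pi // cval_sgX // mcoeffX. Qed.

Lemma rcoefZ_resX (a : A) g h : g \in omega R H -> res_mon h ->
  rcoef (a *: resX g) h = (val a * 'X_[g])@_h.
Proof.
move=> gO hS; rewrite -[_ *: _]/(quotmod_scale _ _) quotmod_scale_pi rcoef_pi //.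
by rewrite cvalZ cval_sgX.
Qed.

Lemma resX_span (v : E) : exists2 s : seq mon, {subset s <= res_mon} &
  v = \sum_(h <- s) sgC (rcoef v h) *: resX h.
Proof.
exists [seq h <- msupp (cval (repr v)) | res_mon h].
  by move=> h; rewrite mem_filter => /andP[].
apply: rcoefP => h hS; rewrite rcoef_sum //.
rewrite (eq_big_seq (fun g => rcoef v g * (g == h)%:R)) => [|g]; last first.
  by rewrite mem_filter => /andP[/andP[gO _] _]; rewrite rcoefZC // rcoef_resX.
have [hv|hv] := boolP (h \in msupp (cval (repr v))).
  rewrite (bigD1_seq h) ?filter_uniq ?mem_filter ?hS //= eqxx mulr1.
  by rewrite big1 ?addr0 // => g /negPf ->; rewrite mulr0.
rewrite [LHS]memN_msupp_eq0 // big_seq big1 // => g.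
rewrite mem_filter => /andP[_ gv]; case: eqP => [e|_]; last by rewrite mulr0.
by rewrite e (negPf hv) in gv.
Qed.

Lemma rcoefZ_neq0 (a : A) (v : E) h : res_mon h -> rcoef (a *: v) h != 0 ->
  exists g k, [/\ h = (g + k)%MM, (val a)@_g != 0, g \in H, res_mon k & rcoef v k != 0].
Proof.
move=> hS; rewrite rcoefZ // => /mcoeffM_neq0[g [k [hE ag vk]]].
have gH := sgring_supp ag; exists g, k; split=> //.
rewrite /res_mon (cval_supp vk) /=; apply/asboolP => -[k' k'H kE].
case/andP: hS => _ /asboolP; apply; exists (g + k')%MM; first exact: submonoid2_D.
by rewrite hE -kE !addmA [(b + g)%MM]addmC.
Qed.

End SemigroupModule.

(** * Monomial submodules: lengths and numbers of generators *)

Section LengthsAndGenerators.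
Variables (K : fieldType) (H : submonoid2) (R : realType) (b : mon).
Hypothesis omegaH : {subset omega R H <= H}.

Local Notation A := (sgring K H).
Local Notation E := (quotmod (in_principal (K := K) (H := H) (R := R) b)).
Local Notation S := (res_mon H R b).
Local Notation resXb := (resX K H R b).
Implicit Types (g h k c : mon) (v : E).

Lemma res_mon_omega h : S h -> h \in omega R H. Proof. by case/andP. Qed.

Lemma res_mon_divisor g k : g \in H -> k \in omega R H -> S (g + k)%MM -> S k.
Proof.
move=> gH kO /andP[_ /asboolPn gkb]; rewrite /res_mon kO; apply/asboolPn.
move=> -[k' k'H kE]; apply: gkb; exists (g + k')%MM; first exact: submonoid2_D.
by rewrite -kE !addmA [(b + g)%MM]addmC.
Qed.

Lemma resX_add g k : g \in H -> S k -> resXb (g + k)%MM = sgX K H g *: resXb k.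
Proof.
move=> gH kS; have kO := res_mon_omega kS.
apply: rcoefP => h hS; rewrite rcoefZ_resX // rcoef_resX ?omegaD //.
by rewrite val_sgX // -mpolyXD mcoeffX.
Qed.

Definition supp_in (D : mon -> Prop) : set E :=
  [set v | forall h, S h -> rcoef v h != 0 -> D h].

Definition upclosed (D : mon -> Prop) : Prop :=
  forall g k, g \in H -> D k -> S (g + k)%MM -> D (g + k)%MM.

Lemma supp_in_submodule D : upclosed D -> is_submodule (supp_in D).
Proof.
move=> uD; split=> [h hS|u v uD' vD h hS|a v vD h hS]; first by rewrite rcoef0 ?eqxx.
  rewrite rcoefD //; have [u0|] := eqVneq (rcoef u h) 0; last by move=> ? _; apply: uD'.
  by rewrite u0 add0r; apply: vD.
case/(rcoefZ_neq0 hS) => g [k [hE _ gH kS vk]].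
by rewrite hE; apply: uD => //; [apply: vD | rewrite -hE].
Qed.

Lemma supp_in_sub D (N : set E) : is_submodule N ->
  (forall h, S h -> D h -> N (resXb h)) -> supp_in D `<=` N.
Proof.
move=> nN DN v vD; have [s sS ->] := resX_span omegaH v.
apply: submodule_sum => // h /sS hS; have [n0 _ nZ] := nN.
have [->|vh] := eqVneq (rcoef v h) 0; first by rewrite sgC0 scale0r.
by apply: nZ; apply: DN => //; apply: vD.
Qed.

Lemma resX_supp_in D h : S h -> D h -> supp_in D (resXb h).
Proof.
move=> hS Dh k kS; rewrite rcoef_resX ?res_mon_omega //.
by have [<-|] := eqVneq h k; rewrite ?eqxx.
Qed.

(* The exponents of the monomials spanning m ^ n E. *)
Fixpoint pow_mon n h : Prop :=
  if n is n'.+1 then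
    S h /\ exists c g, [/\ c \in H, c <> 0%MM, pow_mon n' g & h = (c + g)%MM]
  else S h.

Lemma pow_mon_res n h : pow_mon n h -> S h.
Proof. by case: n => [|n] => [|[]]. Qed.

Lemma pow_mon_upclosed n : upclosed (pow_mon n).
Proof.
elim: n => [|n IH] g k gH // [kS [c [k' [cH c0 kn kE]]]] gkS; split=> //.
exists c, (g + k')%MM; rewrite kE !addmA [(c + g)%MM]addmC; split=> //.
apply: IH => //; apply: (res_mon_divisor cH); last by rewrite addmA [(c + g)%MM]addmC -addmA -kE.
by apply: omegaD => //; apply/res_mon_omega/pow_mon_res/kn.
Qed.

(** Both m and E are spanned by monomials, so lengths of E / m^n E become cardinalities of sets of
    exponents. *)
Lemma powmul_maxE n : powmul E (@sgring_max K H) n = supp_in (pow_mon n).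
Proof.
elim: n => [|n IH]; first by apply/seteqP; split=> // v _ h.
rewrite /powmul iterS -[iter n _ _]/(powmul E (@sgring_max K H) n) IH; apply/seteqP; split.
  apply: span_min; first exact: supp_in_submodule (pow_mon_upclosed (n := n.+1)).
  move=> _ [a [u [/sgring_maxP a0 uD ->]]] h hS.
  case/(rcoefZ_neq0 hS) => g [k [hE ag gH kS uk]]; split=> //.
  exists g, k; split=> //; last exact: uD.
  by move=> g0; rewrite g0 a0 eqxx in ag.
apply: supp_in_sub; first exact: span_submodule.
move=> h hS [_ [c [g [cH c0 gn hE]]]]; apply: mem_gens_span.
exists (sgX K H c), (resXb g); split.
- by apply/sgring_maxP; rewrite val_sgX // mcoeffX; case: eqP.
- exact: resX_supp_in (pow_mon_res gn) gn.
- by rewrite hE resX_add //; apply: pow_mon_res gn.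
Qed.

(** The missing exponents are added one at a time by decreasing degree. Multiplication by a
    nonconstant monomial raises the degree, so every stage is closed under the action of H. *)
Lemma colength_chain D (L : seq mon) : upclosed D -> uniq L ->
  (forall h, h \in L <-> S h /\ ~ D h) ->
  exists N : nat -> set E,
    [/\ forall i, (i <= size L)%N -> is_submodule (N i) /\ supp_in D `<=` N i
      & forall i, (i < size L)%N -> N i `<` N i.+1].
Proof.
move=> uD uL LE; pose r : rel mon := fun g h => (mdeg h <= mdeg g)%N.
pose L' := sort r L; have memL' : L' =i L by apply/perm_mem; rewrite perm_sort.
have sizeL' : size L' = size L by rewrite size_sort.
have sL' : sorted r L' by apply: sort_sorted => g h; apply: leq_total.
have uL' : uniq L' by rewrite sort_uniq.
have r_trans : transitive r by move=> g h k; rewrite /r => gh /leq_trans; apply.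
pose D' i h := D h \/ h \in take i L'.
have LS h : h \in L' -> S h by rewrite memL' => /LE[].
have uD' i : upclosed (D' i).
  move=> g k gH [Dk|kL] gkS; first by left; apply: uD.
  have [Dgk|nDgk] := pselect (D (g + k)%MM); first by left.
  right; have kL' := mem_take kL.
  have gkL' : (g + k)%MM \in L' by rewrite memL'; apply/LE.
  have [->|g0] := eqVneq g 0%MM; first by rewrite add0m.
  rewrite in_take //; apply: (leq_ltn_trans _ (etrans (esym (in_take i kL')) kL)).
  rewrite leqNgt; apply/negP => /(sorted_ltn_index r_trans sL' _ _ kL' gkL').
  by rewrite /r mdegD -[leqRHS]add0n leq_add2r leqNgt lt0n mdeg_eq0 g0.
exists (fun i => supp_in (D' i)); split=> i iL.
  split; first exact: supp_in_submodule.
  by move=> v vD h hS vh; left; apply: vD.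
have iL' : (i < size L')%N by rewrite sizeL'.
split.
  move=> v vD h hS /(vD h hS)[Dh|hi]; [by left|right].
  by rewrite (take_nth 0%MM) // mem_rcons inE hi orbT.
have nL : nth 0%MM L' i \in L' by rewrite mem_nth.
move=> /(_ (resXb (nth 0%MM L' i))) sub.
have nS := LS _ nL; have ND : supp_in (D' i) (resXb (nth 0%MM L' i)).
  apply: sub; apply: resX_supp_in => //.
  by right; rewrite (take_nth 0%MM) // mem_rcons mem_head.
have := ND _ nS; rewrite rcoef_resX ?res_mon_omega // eqxx oner_eq0 => /(_ isT)[Dn|].
  by move: nL; rewrite memL' => /LE[].
by rewrite in_take // index_uniq // ltnn.
Qed.

(** Choose v_i in N_(i+1) but not in N_i. With more v_i than exponents in L, a nonzero K-combination
    has no coefficient on L, so it lies in every N_i; its term of largest index i would then lie in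
    N_i. *)
Lemma colength_le D (L : seq mon) (l : nat) (N : nat -> set E) :
  (forall h, S h -> ~ D h -> h \in L) ->
  (forall i, (i <= l)%N -> is_submodule (N i) /\ supp_in D `<=` N i) ->
  (forall i, (i < l)%N -> N i `<` N i.+1) -> (l <= size L)%N.
Proof.
move=> LE Nsub Nlt; rewrite leqNgt; apply/negP => Lk.
have Nmono i j : (i <= j)%N -> (j <= l)%N -> N i `<=` N j.
  elim: j => [|j IH]; first by rewrite leqn0 => /eqP -> _ u.
  rewrite leq_eqVlt => /orP[/eqP -> _ u //|ij jk].
  by move=> u /(IH ij (ltnW jk)); have [+ _] := Nlt j jk; apply.
have /choice[v vP] : forall i : 'I_l, exists u, N i.+1 u /\ ~ N i u.
  move=> i; have [_ /existsNP[u /not_implyP[u1 u0]]] := Nlt i (ltn_ord i).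
  by exists u.
pose M := \matrix_(i < l, j < size L) rcoef (v i) (nth 0%MM L j).
have [c c0 cM] := left_kernel_neq0 M Lk.
have [i1 ci1] : exists i, c 0 i != 0.
  by apply/rV0Pn.
pose w := \sum_(i < l) sgC H (c 0 i) *: v i.
have wD : supp_in D w.
  move=> h hS wh; apply: contrapT => nD; have hL := LE h hS nD.
  case/eqP: wh; have hi : (index h L < size L)%N by rewrite index_mem.
  move/matrixP: cM => /(_ 0 (Ordinal hi)); rewrite !mxE /w rcoef_sum // => cM.
  by rewrite -[RHS]cM; apply: eq_bigr => i _; rewrite rcoefZC // mxE /= nth_index.
case: (@arg_maxnP _ i1 (fun i => c 0 i != 0) (fun i => i) ci1) => i ci imax.
have [nNi DN] := Nsub i (ltnW (ltn_ord i)); have [iN0 iND iNZ] := nNi.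
case: (vP i) => _; apply.
rewrite -[v i]scale1r -(sgC_inv H ci) -scalerA; apply: (iNZ).
have -> : sgC H (c 0 i) *: v i = w - \sum_(j < l | j != i) sgC H (c 0 j) *: v j.
  by rewrite /w (bigD1 i) //= addrK.
apply: submoduleB => //; first by apply: DN.
rewrite -big_filter; apply: submodule_sum => // j; rewrite mem_filter => /andP[ji _].
have [cj|cj] := eqVneq (c 0 j) 0; first by rewrite cj sgC0 scale0r.
apply: iNZ; have [vj _] := vP j; apply: Nmono vj; last exact/ltnW.
by rewrite ltn_neqAle ji; apply: imax.
Qed.

Lemma supp_in_colength D (L : seq mon) : upclosed D -> uniq L ->
  (forall h, h \in L <-> S h /\ ~ D h) -> is_colength (supp_in D) (size L).
Proof.
move=> uD uL LE; split; first exact: colength_chain.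
move=> k [N [Nsub Nlt]]; apply: (@colength_le D L k N) => // h hS nD.
by apply/LE.
Qed.

(** Graded Nakayama: an exponent in m E is reduced to one of smaller degree. *)
Lemma pow_mon1_gens (G : seq mon) : {subset G <= S} ->
  (forall h, S h -> h \in G \/ pow_mon 1 h) ->
  span [set` map resXb G] = [set: E].
Proof.
move=> GS GP; apply/seteqP; split=> // v _.
have hG h : S h -> span [set` map resXb G] (resXb h).
  move: {2}(mdeg h).+1 (ltnSn (mdeg h)) => m; elim: m h => // m IH h hm hS.
  have [hG|[_ [c [g [cH c0 gS hE]]]]] := GP h hS.
    by apply: mem_gens_span; rewrite /= map_f.
  rewrite hE resX_add //; have [_ _] := span_submodule [set` map resXb G]; apply.
  apply: IH => //; rewrite -ltnS; apply: leq_trans hm; rewrite ltnS hE mdegD -[leqLHS]add1n.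
  by rewrite leq_add2r lt0n mdeg_eq0; apply/eqP.
have vS : supp_in S v by move=> h hS _.
by apply: (supp_in_sub (span_submodule _) _ vS) => h hS _; apply: hG.
Qed.

(** Dual form of Nakayama: at an exponent outside m E, the coefficient of a v is the constant term
    of a times that of v. Hence the kernel of a combination of such coefficients is a submodule, and
    a combination vanishing on s vanishes on E. *)
Lemma min_gens_ge (T : seq mon) (s : seq E) : uniq T ->
  (forall h, h \in T -> S h /\ ~ pow_mon 1 h) ->
  span [set` s] = [set: E] -> (size T <= size s)%N.
Proof.
move=> uT TP sE; rewrite leqNgt; apply/negP => sT.
pose M := \matrix_(j < size T, i < size s) rcoef s`_i (nth 0%MM T j).
have [c c0 cM] := left_kernel_neq0 M sT.
have TS j : (j < size T)%N -> S (nth 0%MM T j) by move=> jT; apply: (TP _ _).1; rewrite mem_nth.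
pose N : set E := [set v | \sum_(j < size T) c 0 j * rcoef v (nth 0%MM T j) = 0].
have nN : is_submodule N.
  split; rewrite /N /=.
  - by rewrite big1 // => j _; rewrite rcoef0 ?mulr0 ?TS.
  - move=> u v uN vN; have := congr2 +%R uN vN; rewrite addr0 -big_split => uv; apply: etrans uv.
    by apply: eq_bigr => j _; rewrite rcoefD ?TS // mulrDr.
  - move=> a v vN; have := congr1 ( *%R (val a)@_0%MM) vN; rewrite mulr0 mulr_sumr => av; apply: etrans av.
    apply: eq_bigr => j _; rewrite mulrCA; congr (_ * _).
    have jS := TS _ (ltn_ord j); set h := nth 0%MM T j in jS *.
    rewrite rcoefZ // -[in LHS](add0m h); apply: mcoeffM_at => g k.
    rewrite add0m => hE ag vk; apply: contrapT => g0.
    have [_ []] := TP h (mem_nth _ (ltn_ord j)); split=> //.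
    exists g, k; split=> //; first exact: sgring_supp ag.
    apply: (res_mon_divisor (sgring_supp ag)); last by rewrite -hE.
    exact: cval_supp vk.
have /rV0Pn[j0 cj0] := c0.
have : N (resXb (nth 0%MM T j0)).
  have : [set: E] (resXb (nth 0%MM T j0)) by [].
  rewrite -sE; apply: span_min => // u us; rewrite /N /=.
  have ui : (index u s < size s)%N by rewrite index_mem.
  move/matrixP: cM => /(_ 0 (Ordinal ui)); rewrite !mxE => cM.
  by apply: etrans cM; apply: eq_bigr => i _; rewrite mxE /= nth_index.
rewrite /N /= (bigD1 j0) //= rcoef_resX ?res_mon_omega ?TS // eqxx mulr1.
rewrite big1 ?addr0 => [/eqP|j jj0]; first by rewrite (negPf cj0).
rewrite rcoef_resX ?res_mon_omega ?TS // nth_uniq //.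
by case: eqP => [/val_inj e|]; [rewrite e eqxx in jj0 | rewrite mulr0].
Qed.

End LengthsAndGenerators.

(** * Combinatorics of the residual monomials *)

Section OneSide.
Variables (H : submonoid2) (R : realType) (a1 a2 b : mon) (l1 l2 : mon -> int) (D : int).
Hypothesis C : coords R H a1 a2 l1 l2 D.

Local Notation S := (res_mon H R b).
Local Notation pow_mon := (pow_mon H R b).
Implicit Types (g h k c : mon).

Lemma coords_omegaH : {subset omega R H <= H}.
Proof.
by move=> h; rewrite (omega_coords C) (mem_coords C) => /andP[/ltW -> /ltW ->].
Qed.

Lemma coord1_0 : l1 0%MM = 0.
Proof. by have := coord1D C 0%MM 0%MM; rewrite addm0; lia. Qed.

Lemma coord2_0 : l2 0%MM = 0.
Proof. by have := coord2D C 0%MM 0%MM; rewrite addm0; lia. Qed.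

Lemma coords_eq0 h : l1 h = 0 -> l2 h = 0 -> h = 0%MM.
Proof.
move=> h1 h2; have hH : h \in H by rewrite (mem_coords C) h1 h2.
have [M /(_ h hH)[_ _]] := coords_mdeg C.
rewrite h1 h2 addr0 mulr0 => h0; apply/eqP; rewrite -mdeg_eq0; lia.
Qed.

Lemma mem_coordsP h : h \in H <-> 0 <= l1 h /\ 0 <= l2 h.
Proof. by rewrite (mem_coords C); split=> /andP. Qed.

Lemma omega_coordsP h : h \in omega R H <-> 0 < l1 h /\ 0 < l2 h.
Proof. by rewrite (omega_coords C); split=> /andP. Qed.

Lemma translate_coords g h :
  translate g H h <-> l1 g <= l1 h /\ l2 g <= l2 h.
Proof.
split=> [[k /mem_coordsP kH <-]|[h1 h2]].
  by rewrite (coord1D C) (coord2D C); lia.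
have [k hE] := coords_le C h1 h2; exists k => //; apply/mem_coordsP.
by move: h1 h2; rewrite hE (coord1D C) (coord2D C); lia.
Qed.

Lemma translateP g h : translate g H h <-> exists2 k, k \in H & h = (g + k)%MM.
Proof. by split=> -[k ? ?]; exists k. Qed.

Lemma res_monP h :
  S h <-> [/\ 0 < l1 h, 0 < l2 h & l1 h < l1 b \/ l2 h < l2 b].
Proof.
split=> [/andP[/omega_coordsP[h1 h2] /asboolPn]|[h1 h2 hb]].
  by rewrite (propext (translate_coords b h)) => nb; split=> //; lia.
apply/andP; split; first exact/omega_coordsP.
by apply/asboolPn; rewrite (propext (translate_coords b h)); lia.
Qed.

Lemma coords_inj g h : l1 g = l1 h -> l2 g = l2 h -> g = h.
Proof.
move=> e1 e2; have [k kE] : exists k, h = (g + k)%MM.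
  by apply: (coords_le C); rewrite ?e1 ?e2.
move: e1 e2; rewrite kE (coord1D C) (coord2D C) => e1 e2.
by rewrite (@coords_eq0 k) ?addm0 //; lia.
Qed.

Lemma face1_divisor c : c \in H -> c <> 0%MM -> l1 c = 0 ->
  exists2 k, k \in H & c = (a1 + k)%MM.
Proof.
move=> cH c0 c1; apply/translateP/translate_coords.
rewrite (coord1_a1 C) (coord2_a1 C) c1; split=> //; apply: (coord1_face C) => //.
have /mem_coordsP[_] := cH; rewrite le_eqVlt => /orP[/eqP c2|//].
by case: c0; apply: coords_eq0.
Qed.

Lemma strip1_translate h c : S h -> l1 (c + h)%MM < l1 b -> c \in H -> S (c + h)%MM.
Proof.
move=> /res_monP[h1 h2 _] lt1 /mem_coordsP[c1 c2]; apply/res_monP.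
by move: lt1; rewrite (coord1D C) (coord2D C) => lt1; split; lia.
Qed.

(** If all n factors had positive [l1], then l1 h > n, as the residual exponent they multiply has
    positive [l1] too. So some factor lies on the face l1 = 0, and a1 can be split off from it. *)
Lemma strip1_pow n h : pow_mon n h -> l1 h < l1 b -> l1 h <= n%:Z ->
  exists g, pow_mon n.-1 g /\ h = (a1 + g)%MM.
Proof.
elim: n h => [|n IH] h.
  by move=> /res_monP[h1 _ _] _; lia.
move=> [hS [c [g [cH c0 gn hE]]]] hb hn.
have gS := pow_mon_res gn; have /res_monP[g1 g2 _] := gS.
have hE1 : l1 h = l1 c + l1 g by rewrite hE (coord1D C).
have [c1|c1] : l1 c = 0 \/ 0 < l1 c by have /mem_coordsP := cH; lia.
  have [k kH cE] := face1_divisor cH c0 c1.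
  exists (k + g)%MM; rewrite addmA -cE; split=> //.
  apply: pow_mon_upclosed => //.
  apply: strip1_translate => //; move: hE1; rewrite cE !(coord1D C) (coord1_a1 C); lia.
have [|//|k [kn gE]] := IH g gn; [lia|lia|].
have k1 : l1 g = l1 k by rewrite gE (coord1D C) (coord1_a1 C) add0r.
exists (c + k)%MM; split; last by rewrite hE gE !addmA [(a1 + c)%MM]addmC.
have ckS : S (c + k)%MM.
  by apply: strip1_translate => //; [apply: pow_mon_res kn | rewrite (coord1D C); lia].
case: n IH gn kn hn => [|n] _ gn kn hn; first by move: hn; lia.
by split=> //; exists c, k.
Qed.

(** Beyond D, subtracting a1 stays in the strip. This bound makes the set of roots finite. *)
Lemma strip1_indecomposable h : S h -> l1 h < l1 b ->
  ~ (exists2 g, S g & h = (a1 + g)%MM) -> l2 h <= D.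
Proof.
move=> /res_monP[h1 h2 _] hb nh; rewrite leNgt; apply/negP => Dh; apply: nh.
have /translateP[k kH hE] : translate a1 H h.
  by apply/translate_coords; rewrite (coord1_a1 C) (coord2_a1 C); lia.
exists k => //; apply/res_monP; move: h1 h2 hb Dh.
rewrite hE (coord1D C) (coord2D C) (coord1_a1 C) (coord2_a1 C) => *.
by split; lia.
Qed.

Hypothesis bO : b \in omega R H.
Hypothesis b_irr : forall g h, g \in H -> h \in H -> b = (g + h)%MM ->
  g = 0%MM \/ h = 0%MM.
Hypotheses (ba1 : b <> a1) (ba2 : b <> a2).

(** A coordinate of b reaching D would make a1 or a2 a proper divisor of the irreducible b. *)
Lemma coords_b : [/\ 0 < l1 b < D & 0 < l2 b < D].
Proof.
have [b1 b2] := (omega_coordsP b).1 bO.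
have D0 := coord_gt0 C.
have aH a : l1 a = 0 /\ l2 a = D \/ l1 a = D /\ l2 a = 0 -> a \in H.
  by move=> aE; apply/mem_coordsP; case: aE; lia.
have no a : l1 a = 0 /\ l2 a = D \/ l1 a = D /\ l2 a = 0 -> b <> a ->
    ~ (l1 a <= l1 b /\ l2 a <= l2 b).
  move=> aE ba /translate_coords/translateP[k kH bE].
  have [a0|k0] := b_irr (aH _ aE) kH bE.
    by move: aE; rewrite a0 coord1_0 coord2_0; lia.
  by rewrite k0 addm0 in bE.
have := no a1; have := no a2; rewrite (coord1_a1 C) (coord1_a2 C) (coord2_a1 C) (coord2_a2 C).
move=> /(_ (or_intror (conj erefl erefl)) ba2) n2 /(_ (or_introl (conj erefl erefl)) ba1) n1.
lia.
Qed.

(* Otherwise b = h + (b - h) would be reducible. *)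
Lemma res_mon_disjoint h : S h -> l1 h < l1 b -> l2 b <= l2 h.
Proof.
move=> /res_monP[h1 h2 _] lt1; rewrite leNgt; apply/negP => lt2.
have /translateP[k kH bE] : translate h H b by apply/translate_coords; lia.
have hH : h \in H by apply/mem_coordsP; lia.
have [h0|k0] := b_irr hH kH bE; first by rewrite h0 coord1_0 in h1.
by move: lt1; rewrite bE k0 addm0; lia.
Qed.

Variable B : set mon.
Hypothesis B_irr : forall c, B c -> [/\ c \in H, c <> 0%MM
  & forall g h, g \in H -> h \in H -> c = (g + h)%MM -> g = 0%MM \/ h = 0%MM].
Hypothesis B_div : forall h, h \in H -> h <> 0%MM ->
  exists c k, [/\ B c, k \in H & h = (c + k)%MM].

Lemma irreducible_face1 c : B c -> l1 c = 0 -> c = a1.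
Proof.
move=> /B_irr[cH c0 cI] c1; have [k kH cE] := face1_divisor cH c0 c1.
have a1H : a1 \in H.
  by apply/mem_coordsP; rewrite (coord1_a1 C) (coord2_a1 C) (ltW (coord_gt0 C)).
have [a0|k0] := cI _ _ a1H kH cE; last by rewrite cE k0 addm0.
by have := coord2_a1 C; have := coord_gt0 C; rewrite a0 coord2_0 => + e; rewrite -e ltxx.
Qed.

Definition sum_condition : Prop := forall c1 c2, B c1 -> B c2 ->
  (translate b H `|` translate a1 H `|` translate a2 H) (c1 + c2)%MM.

(** Apply the condition to basis elements c' and g' dividing c and g. As l1 (c' + g') <= l1 h < l1 b
    < D, membership in b + H or a2 + H is impossible, which leaves a1 + H. *)
Lemma strip1_from_condition h : sum_condition -> S h -> l1 h < l1 b ->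
  pow_mon 1 h -> exists2 g, S g & h = (a1 + g)%MM.
Proof.
move=> cond hS hb [_ [c [g [cH c0 gS hE]]]].
have /res_monP[h1 h2 _] := hS.
have gO := res_mon_omega gS; have gH := coords_omegaH gO.
have /omega_coordsP[g1 g2] := gO.
have hE1 : l1 h = l1 c + l1 g by rewrite hE (coord1D C).
have hE2 : l2 h = l2 c + l2 g by rewrite hE (coord2D C).
have [/andP[b1 bD] /andP[b2 _]] := coords_b.
(* The cofactor k must be residual, not only in H: if l2 k = 0, then k lies on the ray of a2 and l1
   k >= D, too large for the strip. *)
have finish k : k \in H -> h = (a1 + k)%MM -> exists2 g, S g & h = (a1 + g)%MM.
  move=> /mem_coordsP[k1 k2] kE; exists k => //; apply/res_monP.
  have e1 : l1 h = l1 k by rewrite kE (coord1D C) (coord1_a1 C) add0r.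
  have [k20|] : l2 k = 0 \/ 0 < l2 k by lia.
    have : D <= l1 k; last by lia.
    by apply: (coord2_face C) => //; [apply/mem_coordsP; lia | lia].
  by split; lia.
have g0 : g <> 0%MM by move=> g0; rewrite g0 coord1_0 in g1.
have [c' [c'' [Bc c''H cE]]] := B_div cH c0.
have [g' [g'' [Bg g''H gE]]] := B_div gH g0.
have /mem_coordsP[c''1 c''2] := c''H; have /mem_coordsP[g''1 g''2] := g''H.
have cgE : h = ((c' + g') + (c'' + g''))%MM.
  by rewrite hE cE gE !addmA; congr (_ + _)%MM; rewrite -!addmA [(c'' + g')%MM]addmC.
have cg''H : (c'' + g'')%MM \in H by apply: submonoid2_D.
have e1 : l1 (c' + g')%MM <= l1 h.
  by rewrite cgE [l1 (_ + (c'' + g''))%MM](coord1D C) [l1 (c'' + g'')%MM](coord1D C); lia.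
case: (cond _ _ Bc Bg) => [[|]|] /translate_coords.
- by lia.
- move/translate_coords/translateP => [k kH kE].
  apply: (finish (k + (c'' + g''))%MM); first exact: submonoid2_D.
  by rewrite addmA -kE.
- by rewrite (coord1_a2 C); lia.
Qed.

(** If the sum leaves the strip, its [l1] reaches l1 b, while its [l2] already exceeds l2 b by
    disjointness of the strips: b divides it. Otherwise it is an element of m E inside the strip. *)
Lemma condition_from_strip1 c1 c2 :
  (forall h, S h -> l1 h < l1 b -> pow_mon 1 h -> exists2 g, S g & h = (a1 + g)%MM) ->
  c1 \in omega R H -> c2 \in omega R H -> l1 c1 < l1 b ->
  (translate b H `|` translate a1 H) (c1 + c2)%MM.
Proof.
move=> strip /omega_coordsP[x1 x2] /omega_coordsP[y1 y2] lt1.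
have c1S : S c1 by apply/res_monP; split=> //; left.
have le2 := res_mon_disjoint c1S lt1.
have c2H : c2 \in H by apply/mem_coordsP; lia.
have [lt|ge] : l1 (c1 + c2)%MM < l1 b \/ l1 b <= l1 (c1 + c2)%MM by lia.
  right; have sS : S (c2 + c1)%MM by apply: strip1_translate; rewrite // addmC.
  rewrite addmC in lt *.
  have [|g /res_mon_omega/coords_omegaH gH gE] := strip _ sS lt.
    split=> //; exists c2, c1; split=> // c20.
    by rewrite c20 coord1_0 in y1.
  by apply/translateP; exists g.
by left; apply/translate_coords; split=> //; rewrite (coord2D C); lia.
Qed.

End OneSide.

Lemma mdeg_lt_enum (d : nat) :
  exists2 s : seq mon, uniq s & forall h, (h \in s) = (mdeg h < d)%N.
Proof.
exists (map (@bmnm 2 d) (enum {: 'X_{1..2 < d}})).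
  by rewrite map_inj_uniq ?enum_uniq //; apply: val_inj.
move=> h; apply/mapP/idP => [[m _ ->]|hd]; first exact: bmdeg.
by exists (BMultinom hd); rewrite ?mem_enum.
Qed.

(** * Translation along the rays *)

Section Shift.
Variables (H : submonoid2) (R : realType) (a1 a2 b : mon) (l1 l2 : mon -> int) (D : int).
Hypothesis C : coords R H a1 a2 l1 l2 D.

Local Notation S := (res_mon H R b).
Local Notation pow_mon := (pow_mon H R b).
Local Notation C' := (coords_swap C).
Implicit Types (g h k c : mon).

(** Testing [l1] alone suffices: a residual exponent with l1 h >= l1 b is in the strip of [l2]. *)
Definition ray h : mon := if l1 h < l1 b then a1 else a2.
Definition shift h : mon := (ray h + h)%MM.

Lemma ray_cases h : S h ->
  l1 h < l1 b /\ ray h = a1 \/ [/\ l2 h < l2 b, l1 b <= l1 h & ray h = a2].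
Proof.
rewrite /ray => hS; have /(res_monP b C)[_ _ hb] := hS.
case: ltP => h1; [by left | right; split=> //].
by case: hb => //; rewrite ltNge h1.
Qed.

Lemma ray_mem h : ray h \in H.
Proof.
have D0 := ltW (coord_gt0 C).
by rewrite /ray; case: ifP => _; apply/(mem_coordsP C);
  rewrite ?(coord1_a1 C) ?(coord2_a1 C) ?(coord1_a2 C) ?(coord2_a2 C).
Qed.

Lemma ray_neq0 h : ray h <> 0%MM.
Proof.
have D0 := coord_gt0 C; rewrite /ray; case: ifP => _ e.
  by have := coord2_a1 C; rewrite e (coord2_0 C) => e0; rewrite -e0 in D0.
by have := coord1_a2 C; rewrite e (coord1_0 C) => e0; rewrite -e0 in D0.
Qed.

Lemma ray_shift h : S h -> ray (shift h) = ray h.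
Proof.
move=> hS; have [[h1 r]|[h2 h1 r]] := ray_cases hS; rewrite r /shift r /ray (coord1D C).
  by rewrite (coord1_a1 C) add0r h1.
have D0 := coord_gt0 C.
by case: ifP => //; rewrite (coord1_a2 C); lia.
Qed.

Lemma shift_res h : S h -> S (shift h).
Proof.
move=> hS; have rH := ray_mem h; rewrite /shift.
have [[h1 r]|[h2 h1 r]] := ray_cases hS; rewrite r in rH *.
  by apply: (strip1_translate C) => //; rewrite (coord1D C) (coord1_a1 C) add0r.
by apply: (strip1_translate C') => //; rewrite (coord2D C) (coord2_a2 C) add0r.
Qed.

(** A shift stays in its strip, so the ray that was added can be recovered from the result. *)
Lemma shift_inj : {in S &, injective shift}.
Proof.
move=> g h gS hS e; have := congr1 ray e; rewrite !ray_shift // => re.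
by move: e; rewrite /shift re; apply: addmI.
Qed.

Lemma shift_pow n h : pow_mon n h -> pow_mon n.+1 (shift h).
Proof.
move=> hn; split; first exact/shift_res/pow_mon_res/hn.
by exists (ray h), h; split=> //; [apply: ray_mem | apply: ray_neq0].
Qed.

Hypothesis bO : b \in omega R H.
Hypothesis b_irr : forall g h, g \in H -> h \in H -> b = (g + h)%MM ->
  g = 0%MM \/ h = 0%MM.
Hypotheses (ba1 : b <> a1) (ba2 : b <> a2).

Lemma shift_eq1 g : l1 (a1 + g)%MM < l1 b -> (a1 + g)%MM = shift g.
Proof. by rewrite (coord1D C) (coord1_a1 C) add0r /shift /ray => ->. Qed.

Lemma shift_eq2 g : S g -> l2 (a2 + g)%MM < l2 b -> (a2 + g)%MM = shift g.
Proof.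
rewrite (coord2D C) (coord2_a2 C) add0r => gS gb.
have [[g1 _]|[_ _ r]] := ray_cases gS; last by rewrite /shift r.
by have := res_mon_disjoint C bO b_irr gS g1; rewrite leNgt gb.
Qed.

(** The threshold l1 b + l2 b puts both strips at once in the range where every product contains a
    factor on the relevant ray. *)
Lemma pow_shift n h : l1 b + l2 b <= n%:Z -> pow_mon n.+1 h ->
  exists2 g, pow_mon n g & h = shift g.
Proof.
move=> bn hn; have hS := pow_mon_res hn.
have [/andP[b1 _] /andP[b2 _]] := coords_b C bO b_irr ba1 ba2.
have [[h1 r]|[h2 h1 r]] := ray_cases hS.
  have [|g [gn gE]] := strip1_pow C hn h1; first by lia.
  by exists g; rewrite // gE; apply: shift_eq1; rewrite -gE.
have [|g [gn gE]] := strip1_pow C' hn h2; first by lia.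
by exists g; rewrite // gE; apply: shift_eq2; rewrite -?gE // (pow_mon_res gn).
Qed.

(* The exponents of a basis of E / (x^a1 + x^a2) E. *)
Lemma shift_roots : exists2 T : seq mon, uniq T &
  forall h, h \in T <-> S h /\ ~ exists2 g, S g & h = shift g.
Proof.
have [M Mb] := coords_mdeg C.
(* Both coordinates of a root are at most D, so [coords_mdeg] bounds its degree by M (D + D). *)
have [s us sE] := mdeg_lt_enum (absz (M * (D + D))).+1.
exists [seq h <- s | `[< S h /\ ~ exists2 g, S g & h = shift g >]].
  by rewrite filter_uniq.
move=> h; rewrite mem_filter sE; split=> [/andP[/asboolP] //|hT].
apply/andP; split; first exact/asboolP.
have [hS nh] := hT; have hO := res_mon_omega hS; have hH := coords_omegaH C hO.
have /(omega_coordsP C)[h1 h2] := hO.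
have [/andP[b1 bD] /andP[b2 bD2]] := coords_b C bO b_irr ba1 ba2.
have [_ _ hM] := Mb h hH.
have M0 : 0 <= M.
  by have := Mb b (coords_omegaH C bO); nia.
have [l1D l2D] : l1 h <= D /\ l2 h <= D.
  have [[hb r]|[hb _ r]] := ray_cases hS.
    split; first by lia.
    apply: (strip1_indecomposable C hS hb) => -[g gS gE]; apply: nh.
    by exists g; rewrite // gE; apply: shift_eq1; rewrite -gE.
  split; last by lia.
  apply: (strip1_indecomposable C' hS hb) => -[g gS gE]; apply: nh.
  by exists g; rewrite // gE; apply: shift_eq2; rewrite -?gE.
have : M * (l1 h + l2 h) <= M * (D + D) by rewrite ler_wpM2l // lerD.
by rewrite ltnS; lia.
Qed.

Variable T : seq mon.
Hypotheses (T_uniq : uniq T)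
  (TP : forall h, h \in T <-> S h /\ ~ exists2 g, S g & h = shift g).

Lemma root_or_shift h : S h -> h \in T \/ exists2 g, S g & h = shift g.
Proof.
by move=> hS; have [|n] := pselect (exists2 g, S g & h = shift g); [right|left; apply/TP].
Qed.

Lemma co_pow_enum n : exists2 L : seq mon, uniq L & forall h, h \in L <-> S h /\ ~ pow_mon n h.
Proof.
elim: n => [|n [L uL LP]]; first by exists [::] => // h; split=> // -[].
exists [seq h <- undup (T ++ map shift L) | `[< S h /\ ~ pow_mon n.+1 h >]].
  by rewrite filter_uniq ?undup_uniq.
move=> h; rewrite mem_filter mem_undup mem_cat.
split=> [/andP[/asboolP] //|hn]; apply/andP; split; first exact/asboolP.
have [hS nh] := hn; have [->//|[g gS gE]] := root_or_shift hS.
apply/orP; right; rewrite gE map_f //; apply/LP; split=> // gn.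
by apply: nh; rewrite gE; apply: shift_pow.
Qed.

(** Past the threshold, the complement of m^(n+1) E is the disjoint union of the roots and the
    shifted complement of m^n E. *)
Lemma co_pow_size n L L' : l1 b + l2 b <= n%:Z -> uniq L -> uniq L' ->
  (forall h, h \in L <-> S h /\ ~ pow_mon n h) ->
  (forall h, h \in L' <-> S h /\ ~ pow_mon n.+1 h) ->
  size L' = (size T + size L)%N.
Proof.
move=> bn uL uL' LP L'P; rewrite -(size_map shift L) -size_cat; apply: perm_size.
have LS g : g \in L -> S g by move=> /LP[].
apply: uniq_perm => // [|h].
  rewrite cat_uniq T_uniq map_inj_in_uniq ?uL ?andbT => [|g h /LS gS /LS hS]; last exact: shift_inj.
  by apply/hasPn => _ /mapP[g /LS gS ->]; apply/negP => /TP[_ []]; exists g.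
rewrite mem_cat; apply/idP/orP => [/L'P[hS nh]|].
  have [->|[g gS gE]] := root_or_shift hS; first by left.
  right; rewrite gE map_f //; apply/LP; split=> // gn.
  by apply: nh; rewrite gE; apply: shift_pow.
case=> [/TP[hS nh]|/mapP[g /LP[gS ng] ->]]; apply/L'P; split=> //; last first.
- move=> /(pow_shift bn)[g' g'n e]; apply: ng.
  by rewrite (shift_inj gS (pow_mon_res g'n) e).
- exact: shift_res.
by move=> /(pow_shift bn)[g gn e]; apply: nh; exists g => //; apply: pow_mon_res gn.
Qed.

End Shift.

(** * Dimension and depth *)

Section DimensionDepth.
Variables (K : fieldType) (H : submonoid2) (R : realType).
Variables (a1 a2 b : mon) (l1 l2 : mon -> int) (D : int).
Hypothesis C : coords R H a1 a2 l1 l2 D.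

Local Notation A := (sgring K H).
Local Notation E := (quotmod (in_principal (K := K) (H := H) (R := R) b)).
Local Notation S := (res_mon H R b).
Implicit Types (g h k c : mon).

(** Outside b + H one coordinate stays below that of b and the other is at most linear in the
    degree; the two coordinates determine the exponent. *)
Lemma co_translate_growth : exists P : nat, forall d : nat, exists s : seq mon,
  (size s <= P * d.+1)%N /\
  forall h, h \in H -> ~ translate b H h -> (mdeg h <= d)%N -> h \in s.
Proof.
have [M Mb] := coords_mdeg C.
pose m := absz M; pose b1 := absz (l1 b); pose b2 := absz (l2 b).
exists ((b1 + b2) * m.+1)%N => d; have [t ut tE] := mdeg_lt_enum d.+1.
pose W h := `[< h \in H /\ ~ translate b H h >].
exists [seq h <- t | W h]; split; last first.
  by move=> h hH hb hd; rewrite mem_filter tE ltnS hd andbT; apply/asboolP.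
pose phi h := (absz (l1 h), absz (l2 h)).
have WP h : h \in [seq h <- t | W h] -> [/\ 0 <= l1 h, 0 <= l2 h,
    l1 h < l1 b \/ l2 h < l2 b & l1 h <= (m * d)%N%:Z /\ l2 h <= (m * d)%N%:Z].
  rewrite mem_filter tE ltnS => /andP[/asboolP[hH nb] hd].
  have [h1 h2] := (mem_coordsP C h).1 hH; split=> //.
    by move: nb; rewrite (propext (translate_coords C b h)); lia.
  have [e1 e2 _] := Mb h hH; rewrite PoszM.
  have mM : M <= m by rewrite /m; lia.
  have Md : M * (mdeg h)%:Z <= m%:Z * d%:Z.
    by apply: (le_trans (ler_wpM2r _ mM)); rewrite // ler_wpM2l.
  by split; [apply: le_trans e1 Md | apply: le_trans e2 Md].
rewrite -(size_map phi).
pose box1 := [seq (x, y) | x <- iota 0 b1, y <- iota 0 (m * d).+1].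
pose box2 := [seq (x, y) | x <- iota 0 (m * d).+1, y <- iota 0 b2].
have /(leq_trans _) : (size (box1 ++ box2) <= (b1 + b2) * m.+1 * d.+1)%N.
  rewrite size_cat !size_allpairs !size_iota; nia.
apply; apply: uniq_leq_size.
  rewrite map_inj_in_uniq ?filter_uniq // => g h /WP[g1 g2 _ _] /WP[h1 h2 _ _] [e1 e2].
  by apply: (coords_inj C); lia.
have in_iota (z : int) (e : nat) : 0 <= z -> z < e%:Z -> absz z \in iota 0 e.
  by move=> z0 ze; rewrite mem_iota; lia.
move=> _ /mapP[h /WP[h1 h2 hb [hm1 hm2]] ->]; rewrite mem_cat; apply/orP.
case: hb => hb; [left|right]; apply/allpairsP; exists (phi h);
  by split=> //; apply: in_iota => //; rewrite /b1 /b2; lia.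
Qed.

Definition deg_le (d : nat) (p : {mpoly K[2]}) : Prop :=
  forall h, p@_h != 0 -> (mdeg h <= d)%N.

Lemma deg_leM d d' p q : deg_le d p -> deg_le d' q -> deg_le (d + d') (p * q).
Proof.
move=> pd qd h /mcoeffM_neq0[g [k [-> /pd gd /qd kd]]].
by rewrite mdegD leq_add.
Qed.

Lemma deg_leX d n p : deg_le d p -> deg_le (n * d) (p ^+ n).
Proof.
move=> pd; elim: n => [|n IH]; last by rewrite exprS mulSn; apply: deg_leM.
move=> h; rewrite expr0 mcoeff1; have [->|_] := eqVneq h 0%MM; last by rewrite eqxx.
by rewrite mdeg0.
Qed.

Lemma deg_le_exists p : exists d, deg_le d p.
Proof.
exists (msize p) => h hp; apply/ltnW/msize_mdeg_lt.
by rewrite mcoeff_msupp.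
Qed.

Lemma deg_le_weaken d d' p : (d <= d')%N -> deg_le d p -> deg_le d' p.
Proof. by move=> dd pd h /pd /leq_trans; apply. Qed.

Lemma val_sgXn (r : A) n : val (r ^+ n) = val r ^+ n.
Proof.
by elim: n => [|n IH]; rewrite ?expr0 ?val_sg1 // !exprS val_sgM IH.
Qed.

(* K[H] / x^b K[H] has linear growth while x^i y^j w, for i, j < n, are n ^ 2
   elements of degree O(n). *)
Lemma bounded_relation (x y w : A) : exists n (c : nat -> nat -> K) (r : A),
  (exists i j, [/\ (i < n)%N, (j < n)%N & c i j != 0]) /\
  val (\sum_(i < n) \sum_(j < n) (x ^+ i * y ^+ j * sgC H (c i j)) * w) = 'X_[b] * val r.
Proof.
have [P growth] := co_translate_growth.
have [dx xd] := deg_le_exists (val x); have [dy yd] := deg_le_exists (val y).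
have [dw wd] := deg_le_exists (val w).
pose m := (dx + dy + dw)%N.
have {}xd : deg_le m (val x) by apply: deg_le_weaken xd; rewrite /m; lia.
have {}yd : deg_le m (val y) by apply: deg_le_weaken yd; rewrite /m; lia.
have {}wd : deg_le m (val w) by apply: deg_le_weaken wd; rewrite /m; lia.
(* Chosen so that P (2nm + m + 1) <= P (3m + 1) n = (n - 1) n < n ^ 2: fewer exponents than
   products. *)
pose n' := (P * (m * 3).+1)%N; pose n := n'.+1.
have [s [sizes sP]] := growth (n * m + n * m + m)%N.
have sn : (size s < n * n)%N.
  apply: leq_ltn_trans sizes _.
  have -> : (n * n = n + P * (m * 3).+1 * n)%N by rewrite /n mulSn.
  have le3 : ((n * m + n * m + m).+1 <= (m * 3).+1 * n)%N.
    by rewrite {1 2}/n; clear; nia.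
  have := leq_mul (leqnn P) le3; rewrite mulnA => le.
  by rewrite (leq_ltn_trans le) // -[ltnLHS]add0n ltn_add2r.
pose F i j : A := x ^+ i * y ^+ j * w.
have Fd (i j : 'I_n) : deg_le (n * m + n * m + m) (val (F i j)).
  rewrite /F !val_sgM !val_sgXn; apply: deg_leM => //; apply: deg_leM.
  - by apply: deg_le_weaken (deg_leX xd); rewrite leq_mul2r ltnW ?orbT.
  - by apply: deg_le_weaken (deg_leX yd); rewrite leq_mul2r ltnW ?orbT.
pose col h := mxvec (\matrix_(i < n, j < n) (val (F i j))@_h).
pose M := \matrix_(q < n * n, t < size s) col (nth 0%MM s t) 0 q.
have [c c0 cM] := left_kernel_neq0 M sn.
pose c' i j := c 0 (mxvec_index (inord i : 'I_n) (inord j : 'I_n)).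
have c'E (i j : 'I_n) : c' i j = c 0 (mxvec_index i j) by rewrite /c' !inord_val.
have pcoef h : (val (\sum_(i < n) \sum_(j < n) (x ^+ i * y ^+ j * sgC H (c' i j)) * w))@_h
    = \sum_(q < n * n) c 0 q * col h 0 q.
  transitivity (\sum_(i < n) \sum_(j < n) c' i j * (val (F i j))@_h).
    rewrite val_sg_sum raddf_sum; apply: eq_bigr => i _ /=.
    rewrite [X in X@__]val_sg_sum raddf_sum; apply: eq_bigr => j _ /=.
    rewrite -[LHS]/((val (x ^+ i * y ^+ j * sgC H (c' i j) * w))@_h).
    by rewrite mulrAC [_ * sgC _ _]mulrC mcoeff_sgCM.
  rewrite (reindex _ (curry_mxvec_bij n n)) /= pair_bigA /=.
  by apply: eq_bigr => -[i j] _; rewrite /= c'E /col mxvecE mxE.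
have /rV0Pn[q cq] := c0; case/mxvec_indexP: q cq => i0 j0 cij.
have [r rE] : exists r : A,
    val (\sum_(i < n) \sum_(j < n) (x ^+ i * y ^+ j * sgC H (c' i j)) * w) = 'X_[b] * val r.
  apply: divisible_by_Xb => h hb; apply/eqP; apply: contraT => ph.
  have hH := sgring_supp ph.
  have hs : h \in s.
    apply: sP => //; move: ph; rewrite pcoef => ph.
    have [q qE] : exists q, col h 0 q != 0.
      apply: contrapT => /forallNP col0; case/eqP: ph; rewrite big1 // => q _.
      by have /negP := col0 q; rewrite negbK => /eqP ->; rewrite mulr0.
    case/mxvec_indexP: q qE => i j; rewrite /col mxvecE mxE; exact: Fd.
  case/eqP: ph; rewrite pcoef; have hi : (index h s < size s)%N by rewrite index_mem.
  move/matrixP: cM => /(_ 0 (Ordinal hi)); rewrite !mxE => cM.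
  by apply: etrans cM; apply: eq_bigr => q _; rewrite mxE /= nth_index.
exists n, c', r; split=> //; exists i0, j0; split=> //.
by rewrite c'E.
Qed.

End DimensionDepth.

(** * Two primes above the annihilator *)

Section FacePrime.
Variables (K : fieldType) (H : submonoid2) (R : realType).
Variables (a1 a2 b : mon) (l1 l2 : mon -> int) (D : int).
Hypothesis C : coords R H a1 a2 l1 l2 D.

Local Notation A := (sgring K H).
Local Notation E := (quotmod (in_principal (K := K) (H := H) (R := R) b)).
Local Notation S := (res_mon H R b).
Implicit Types (g h k c : mon).

(* The kernel of the projection of K[H] onto the face K[N a1]. *)
Definition face_prime : set A := [set r | forall h, l1 h = 0 -> (val r)@_h = 0].

Lemma face_prime_ideal : is_ideal face_prime.
Proof.
split=> [h _|r s rP sP h h0|a s sP h h0].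
- by rewrite [X in X@__](val_sg0 K H) mcoeff0.
- by rewrite [X in X@__](val_sgD (r : A) s) mcoeffD rP ?sP ?addr0.
rewrite [X in X@__](val_sgM (a : A) s); apply/eqP; apply: contraT.
case/mcoeffM_neq0 => g [k [hE /sgring_supp/(mem_coordsP C)[g1 _] sk]].
have /(mem_coordsP C)[k1 _] := sgring_supp sk.
by case/eqP: sk; apply: sP; move: h0; rewrite hE (coord1D C); lia.
Qed.

(** On the face [l2] alone separates exponents, so lowest terms multiply without cancellation;
    primality rests on this. *)
Lemma face_lowest (r : A) : ~ face_prime r -> exists g, [/\ l1 g = 0, (val r)@_g != 0 &
  forall h, l1 h = 0 -> (val r)@_h != 0 -> l2 g <= l2 h].
Proof.
move=> /existsNP[g0 /not_implyP[g01 /eqP rg0]].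
pose P n := `[< exists g, [/\ l1 g = 0, (val r)@_g != 0 & absz (l2 g) = n] >].
have exP : exists n, P n by exists (absz (l2 g0)); apply/asboolP; exists g0.
case: (ex_minnP exP) => n /asboolP[g [g1 rg gn]] nmin.
exists g; split=> // h h1 rh.
have /nmin : P (absz (l2 h)) by apply/asboolP; exists h.
rewrite -gn; have /(mem_coordsP C)[_ g2] := sgring_supp rg.
by have /(mem_coordsP C)[_ h2] := sgring_supp rh; lia.
Qed.

Lemma face_prime_prime : is_prime_ideal face_prime.
Proof.
split; first exact: face_prime_ideal.
  move=> /(_ 0%MM (coord1_0 C))/eqP; rewrite val_sg1 mcoeff1 eqxx oner_eq0.
  by [].
move=> r s rsP; apply: contrapT => /not_orP[/face_lowest[g [g1 rg gmin]]].
move=> /face_lowest[h [h1 sh hmin]].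
have gh1 : l1 (g + h)%MM = 0 by rewrite (coord1D C) g1 h1.
have := rsP _ gh1; rewrite val_sgM mcoeffM_at => [/eqP|g' h' e rg' sh'].
  by rewrite mulf_eq0 (negPf rg) (negPf sh).
have := congr1 l1 e; have := congr1 l2 e; rewrite !(coord1D C) !(coord2D C) g1 h1.
have /(mem_coordsP C)[g'1 _] := sgring_supp rg'.
have /(mem_coordsP C)[h'1 _] := sgring_supp sh' => e2 e1.
have g'10 : l1 g' = 0 by lia.
have h'10 : l1 h' = 0 by lia.
have := gmin _ g'10 rg'; have := hmin _ h'10 sh' => ? ?.
by apply: (coords_inj C); lia.
Qed.

Lemma sgring_max_prime : is_prime_ideal (@sgring_max K H).
Proof.
split; first exact: span_submodule.
  by move=> /sgring_maxP/eqP; rewrite val_sg1 mcoeff1 eqxx oner_eq0.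
move=> r s /sgring_maxP/eqP; rewrite mcoeff0_sgM mulf_eq0.
by move=> /orP[]/eqP e; [left|right]; apply/sgring_maxP.
Qed.

Lemma face_prime_lt_max : face_prime `<` @sgring_max K H.
Proof.
split=> [r rP|sub].
  by apply/sgring_maxP/rP; apply: coord1_0 C.
have a1H : a1 \in H.
  by apply/(mem_coordsP C); rewrite (coord1_a1 C) (coord2_a1 C) (ltW (coord_gt0 C)).
have : sgring_max (sgX K H a1).
  apply/sgring_maxP; rewrite val_sgX // mcoeffX; case: eqP => // a0.
  by have := coord2_a1 C; have := coord_gt0 C; rewrite a0 (coord2_0 C); lia.
move=> /sub/(_ a1 (coord1_a1 C)); rewrite val_sgX // mcoeffX eqxx => /eqP.
by rewrite oner_eq0.
Qed.

(** An exponent g with l1 g = 0 keeps h in its strip, so the coefficient of a at g survives in a x^h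
    at g + h. *)
Lemma ann_sub_face_prime h : S h -> l1 h < l1 b -> ann E `<=` face_prime.
Proof.
move=> hS hb a aE g g1; apply/eqP; apply: contraT => ag.
have gH := sgring_supp ag.
have ghS : S (g + h)%MM.
  by apply: (strip1_translate C) => //; rewrite (coord1D C) g1 add0r.
have := congr1 (fun v => rcoef v (g + h)%MM) (aE (resX K H R b h)).
rewrite (rcoefZ_resX (coords_omegaH C)) ?(res_mon_omega hS) // (rcoef0 K ghS).
by rewrite mulrC [(g + h)%MM]addmC mcoeffXM => /eqP; rewrite (negPf ag).
Qed.

Lemma dim_chain1 h : S h -> l1 h < l1 b -> exists P : nat -> set A,
  [/\ forall i, (i <= 1)%N -> is_prime_ideal (P i) /\ ann E `<=` P i
    & forall i, (i < 1)%N -> P i `<` P i.+1].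
Proof.
move=> hS hb; have annF := ann_sub_face_prime hS hb.
have FM := face_prime_lt_max.
exists (fun i => if i is 0%N then face_prime else @sgring_max K H).
split=> [[|[|//]] _|[|//] _]; split.
- exact: face_prime_prime.
- exact: annF.
- exact: sgring_max_prime.
- by move=> r /annF; have [+ _] := FM; apply.
- by case: FM.
- by case: FM.
Qed.

(** The term x^a2 contributes nothing: it would come from an exponent with [l1] equal to l1 h - D <
    0. *)
Lemma ray_sum_regular (v : E) h : S h -> l1 h < l1 b -> l1 b < D ->
  rcoef ((sgX K H a1 + sgX K H a2) *: v) (a1 + h)%MM = rcoef v h.
Proof.
move=> hS hb bD; have D0 := ltW (coord_gt0 C).
have a1H : a1 \in H by apply/(mem_coordsP C); rewrite (coord1_a1 C) (coord2_a1 C).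
have a2H : a2 \in H by apply/(mem_coordsP C); rewrite (coord1_a2 C) (coord2_a2 C).
have a1hS : S (a1 + h)%MM.
  by apply: (strip1_translate C) => //; rewrite (coord1D C) (coord1_a1 C) add0r.
rewrite rcoefZ // val_sgD !val_sgX // mulrDl mcoeffD mcoeffXM -[RHS]addr0; congr (_ + _).
apply/eqP; apply: contraT => /mcoeffXM_neq0[k /(congr1 l1) + /cval_supp].
rewrite (omega_coords C) !(coord1D C) (coord1_a1 C) (coord1_a2 C) => e /andP[k1 _].
by exfalso; lia.
Qed.

End FacePrime.

(** * Dimension and depth are both one *)

Section DimensionDepthOne.
Variables (K : fieldType) (H : submonoid2) (R : realType).
Variables (a1 a2 b : mon) (l1 l2 : mon -> int) (D : int).
Hypothesis C : coords R H a1 a2 l1 l2 D.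

Local Notation A := (sgring K H).
Local Notation E := (quotmod (in_principal (K := K) (H := H) (R := R) b)).
Local Notation S := (res_mon H R b).
Local Notation C' := (coords_swap C).
Implicit Types (g h k c : mon).

Lemma sgC_0_or_unit (a : K) : sgC H a = 0 \/ exists d, d * sgC H a = 1.
Proof.
have [->|a0] := eqVneq a 0; first by left; apply: sgC0.
by right; exists (sgC H a^-1); apply: sgC_inv.
Qed.

Lemma sgC_neq0 (a : K) : a != 0 -> sgC H a != 0.
Proof.
move=> a0; apply/eqP => e; have := sgC_inv H a0.
by rewrite e mulr0 => /eqP; rewrite eq_sym oner_eq0.
Qed.

Lemma Xb_ann (a r : A) : val a = 'X_[b] * val r -> ann E a.
Proof.
move=> aE v; apply: rcoefP => h hS; rewrite rcoefZ // rcoef0 //.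
apply/eqP; apply: contraT; rewrite aE -mulrA.
case/mcoeffXM_neq0 => k hE /mcoeffM_neq0[g [k' [kE rg vk]]].
case/andP: hS => _ /asboolPn[]; exists k => //.
rewrite kE; apply: submonoid2_D; first exact: sgring_supp rg.
exact/(coords_omegaH C)/(cval_supp vk).
Qed.

(** Three successive primes over ann E would give x in P1 outside P0 and y in P2 outside P1; the
    relation between x and y lies in ann E, hence in P0, and forces 1 into P2. *)
Lemma dim_le1 n (P : nat -> set A) :
  (forall i, (i <= n)%N -> is_prime_ideal (P i) /\ ann E `<=` P i) ->
  (forall i, (i < n)%N -> P i `<` P i.+1) -> (n <= 1)%N.
Proof.
move=> Pprime Plt; rewrite leqNgt; apply/negP => n2.
have [[n0 _ p0] annP] := Pprime 0%N (leq0n _).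
have [[n1 _ p1] _] := Pprime 1%N (ltnW n2).
have [[n2' one2 _] _] := Pprime 2%N n2.
have [P01 /existsNP[x /not_implyP[x1 x0]]] := Plt 0%N (ltnW n2).
have [P12 /existsNP[y /not_implyP[y2 y1]]] := Plt 1%N n2.
have [m [c [r [cN0 rel]]]] := bounded_relation b C x y 1.
apply: one2; apply: (@regular_pair_relation A A^o (P 0%N) (P 1%N) (P 2%N) x y 1 m
  (fun i j => sgC H (c i j))) => //.
- by move=> u /p0[].
- by move=> u; rewrite [x *: u]mulrC; case: n1 => _ _; apply.
- by move=> u /p1[].
- by move=> u; rewrite [y *: u]mulrC; case: n2' => _ _; apply.
- by move=> i j; apply: sgC_0_or_unit.
- by case: cN0 => i [j [? ? /sgC_neq0]]; exists i, j.
exact/annP/(Xb_ann rel).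
Qed.

Lemma smul_mono (X Y : set A) : X `<=` Y -> smul X setT `<=` (smul Y setT : set E).
Proof.
move=> XY; apply: span_min; first exact: span_submodule.
by move=> _ [a [u [Xa _ ->]]]; apply: mem_gens_span; exists a, u; split=> //; apply: XY.
Qed.

Lemma mem_smul (X : set A) x (u : E) : X x -> smul X setT (x *: u).
Proof. by move=> Xx; apply: mem_gens_span; exists x, u. Qed.

Lemma smul_nil (X : set A) : (forall x, ~ X x) -> smul X setT `<=` [set 0 : E].
Proof.
move=> X0; apply: span_min; last by move=> w [a [u [/X0]]].
by split=> [//|u v /= -> ->|a v /= ->]; rewrite ?addr0 ?scaler0.
Qed.

(** The relation between the first two terms kills every v, which puts v in the submodule generated
    by the sequence, against properness. *)
Lemma regular_seq_le1 (I : set A) (s : seq A) :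
  @is_regular_seq A E I s -> (size s <= 1)%N.
Proof.
case=> _ reg sne; rewrite leqNgt; apply/negP => s2; apply: sne.
apply/seteqP; split=> // v _.
pose x := s`_0; pose y := s`_1.
have [m [c [r [cN0 rel]]]] := bounded_relation b C x y 1.
pose N i : set E := smul [set` take i s] setT.
have takeS i j : (i <= j)%N -> N i `<=` N j.
  move=> ij; apply: smul_mono => z /=; rewrite -(minn_idPl ij) take_min.
  exact: mem_take.
have nN i : is_submodule (N i) by apply: span_submodule.
have nS : is_submodule (smul [set` s] setT : set E) by apply: span_submodule.
apply: (@regular_pair_relation A E (N 0%N) (N 1%N) (smul [set` s] setT) x y v m
  (fun i j => sgC H (c i j))) => //.
- exact: takeS.
- by rewrite /N; apply: smul_mono => z /= /mem_take.
- by move=> u; apply: reg; apply: ltnW.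
- by move=> u; apply: mem_smul; rewrite /= (take_nth 0) ?(ltnW s2) // take0 mem_head.
- by move=> u; apply: reg.
- by move=> u; apply: mem_smul; rewrite /= mem_nth.
- by move=> i j; apply: sgC_0_or_unit.
- by case: cN0 => i [j [? ? /sgC_neq0]]; exists i, j.
suff -> : \sum_(i < m) \sum_(j < m) (x ^+ i * y ^+ j * sgC H (c i j)) *: v = 0.
  by case: (nN 0%N).
under eq_bigr do rewrite -scaler_suml; rewrite -scaler_suml.
apply: (Xb_ann (r := r)); rewrite -rel; congr (val _).
by apply: eq_bigr => i _; apply: eq_bigr => j _; rewrite mulr1.
Qed.

Hypothesis bO : b \in omega R H.
Hypothesis b_irr : forall g h, g \in H -> h \in H -> b = (g + h)%MM ->
  g = 0%MM \/ h = 0%MM.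
Hypotheses (ba1 : b <> a1) (ba2 : b <> a2).
Hypothesis S_nonempty : exists h, S h.

Lemma is_dim_E1 : is_dim E 1.
Proof.
split; last by move=> n [P [Pp Plt]]; apply: (dim_le1 Pp Plt).
have [h hS] := S_nonempty; have /(res_monP b C)[_ _ [hb|hb]] := hS.
  exact (dim_chain1 K C hS hb).
exact (dim_chain1 K C' hS hb).
Qed.

Lemma pow_mon1_proper : exists2 h, S h & ~ pow_mon H R b 1 h.
Proof.
have exP : exists n, `[< exists2 h, S h & mdeg h = n >].
  by have [h hS] := S_nonempty; exists (mdeg h); apply/asboolP; exists h.
case: (ex_minnP exP) => n /asboolP[h hS hn] nmin.
exists h => // -[_ [c [g [cH c0 gS hE]]]].
have : (n <= mdeg g)%N by apply/nmin/asboolP; exists g.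
rewrite -hn hE mdegD -[leqRHS]add0n leq_add2r leqn0 mdeg_eq0 => /eqP.
exact: c0.
Qed.

Lemma is_depth_E1 : is_depth E (@sgring_max K H) 1.
Proof.
split; last by move=> n [s [sR <-]]; apply: regular_seq_le1 sR.
have [/andP[_ b1D] /andP[_ b2D]] := coords_b C bO b_irr ba1 ba2.
have D0 := coord_gt0 C.
have a1H : a1 \in H by apply/(mem_coordsP C); rewrite (coord1_a1 C) (coord2_a1 C) (ltW D0).
have a2H : a2 \in H by apply/(mem_coordsP C); rewrite (coord1_a2 C) (coord2_a2 C) (ltW D0).
(* The sum is regular on both strips; x^a1 alone kills the strip of [l2], and x^a2 that of [l1]. *)
pose f : A := sgX K H a1 + sgX K H a2.
have fI : @sgring_max K H f.
  apply/sgring_maxP; rewrite val_sgD mcoeffD !val_sgX // !mcoeffX.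
  case: eqP => [e|_]; first by move: D0; rewrite -(coord2_a1 C) e (coord2_0 C).
  case: eqP => [e|_]; last by rewrite addr0.
  by move: D0; rewrite -(coord1_a2 C) e (coord1_0 C).
have fsub : [set` [:: f]] `<=` @sgring_max K H by move=> x /=; rewrite inE => /eqP ->.
exists [:: f]; split=> //; split=> // [[|//] v _ |e].
  move=> /(@smul_nil _ (fun x => notF)) /= fv0.
  have -> : v = 0; last by case: (span_submodule [set v : E | exists a u, [/\ [set` [::]] a, setT u & v = a *: u]]).
  apply: rcoefP => h hS; rewrite rcoef0 //.
  have /(res_monP b C)[_ _ [hb|hb]] := hS.
    rewrite -(ray_sum_regular C _ hS hb b1D) -/f fv0 rcoef0 //.
    by apply: (strip1_translate C) => //; rewrite (coord1D C) (coord1_a1 C) add0r.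
  rewrite -(ray_sum_regular C' _ hS hb b2D) addrC -/f fv0 rcoef0 //.
  by apply: (strip1_translate C') => //; rewrite (coord2D C) (coord2_a2 C) add0r.
(* If f E = E then m E = E, which a residual exponent of minimal degree refutes. *)
have [h hS hn] := pow_mon1_proper.
have : powmul E (@sgring_max K H) 1 (resX K H R b h).
  by apply: (smul_mono fsub); rewrite e.
rewrite (powmul_maxE K b (coords_omegaH C)) => /(_ h hS).
rewrite (rcoef_resX K (coords_omegaH C)) ?(res_mon_omega hS) // eqxx oner_eq0.
by move=> /(_ isT).
Qed.

End DimensionDepthOne.

(** * Hilbert bases *)

Section HilbertBasis.
Variables (H : submonoid2) (B : set mon).
Hypothesis HB : is_Hilbert_basis B H.
Implicit Types (g h c : mon).

Lemma Hilbert_basis_sub c : B c -> c \in H.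
Proof.
move=> Bc; apply/(HB.1 c); exists [:: c]; rewrite big_seq1; split=> // x /=.
by rewrite inE => /eqP ->.
Qed.

Lemma sum_mem_H (s : seq mon) : [set` s] `<=` B -> (\sum_(g <- s) g)%MM \in H.
Proof. by move=> sB; apply/(HB.1 _); exists s. Qed.

Lemma Hilbert_basis_div h : h \in H -> h <> 0%MM ->
  exists c k, [/\ B c, k \in H & h = (c + k)%MM].
Proof.
move=> /(HB.1 h)[[|c s] [sB ->]]; first by rewrite big_nil.
move=> _; exists c, (\sum_(g <- s) g)%MM; rewrite big_cons; split=> //.
  by apply: sB; rewrite /= mem_head.
by apply: sum_mem_H => x xs; apply: sB; rewrite /= inE [x \in s]xs orbT.
Qed.

(** Replacing each occurrence of c by t, the basis without c would still generate H. *)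
Lemma Hilbert_basis_not_redundant c (t : seq mon) : B c ->
  [set` t] `<=` B -> c \notin t -> c <> (\sum_(g <- t) g)%MM.
Proof.
move=> Bc tB ct cE; pose B' := B `&` [set x | x <> c].
have B'B : B' `<=` B by move=> x [].
have tB' : [set` t] `<=` B'.
  by move=> x xt; split; [apply: tB | move=> xc; rewrite -xc in ct; case/negP: ct].
suff B'gen : generates B' H by have /(congr1 (@^~ c)) := HB.2 B' B'B B'gen; rewrite /B' => e; move: Bc; rewrite -e => -[].
move=> h; split=> [/(HB.1 h)[s [sB ->]]|[s [sB' ->]]]; last first.
  by apply: sum_mem_H => x /sB' [].
elim: s sB => [|x s IH] sB; first by exists [::]; rewrite big_nil.
have [|u [uB' uE]] := IH.
  by move=> y ys; apply: sB; rewrite /= inE [y \in s]ys orbT.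
have Bx : B x by apply: sB; rewrite /= mem_head.
rewrite big_cons uE; have [->|xc] := eqVneq x c.
  exists (t ++ u); rewrite big_cat -cE; split=> // y /=.
  by rewrite mem_cat => /orP[/tB'|/uB'].
exists (x :: u); rewrite big_cons; split=> // y /=.
by rewrite inE => /orP[/eqP ->|/uB' //]; split=> //; apply/eqP.
Qed.

(** In a proper splitting, degrees keep c out of the expansions of both summands, so together they
    express c through the rest of B. *)
Lemma Hilbert_basis_irr c : B c -> [/\ c \in H, c <> 0%MM
  & forall g h, g \in H -> h \in H -> c = (g + h)%MM -> g = 0%MM \/ h = 0%MM].
Proof.
move=> Bc; split; first exact: Hilbert_basis_sub.
  move=> c0; apply: (@Hilbert_basis_not_redundant c [::]) => //.
  by rewrite big_nil.
move=> g h /(HB.1 g)[s [sB sE]] /(HB.1 h)[t [tB tE]] cE.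
apply: contrapT => /not_orP[/eqP g0 /eqP h0].
have le_sum (u : seq mon) : c \in u -> (mdeg c <= mdeg (\sum_(x <- u) x)%MM)%N.
  by move=> cu; rewrite (perm_big _ (perm_to_rem cu)) big_cons mdegD leq_addr.
apply: (@Hilbert_basis_not_redundant c (s ++ t)) => //.
- by move=> x /=; rewrite mem_cat => /orP[/sB|/tB].
- rewrite mem_cat; apply/norP; split; apply/negP => /le_sum.
    by rewrite -sE cE mdegD -[leqRHS]addn0 leq_add2l leqn0 mdeg_eq0 (negPf h0).
  by rewrite -tE cE mdegD -[leqRHS]add0n leq_add2r leqn0 mdeg_eq0 (negPf g0).
- by rewrite big_cat /= -sE -tE.
Qed.

End HilbertBasis.

(** * Multiplicity and Ulrich elements *)

Section Ulrich.
Variables (K : fieldType) (H : submonoid2) (R : realType).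
Variables (a1 a2 b : mon) (l1 l2 : mon -> int) (D : int).
Hypothesis C : coords R H a1 a2 l1 l2 D.
Hypothesis bO : b \in omega R H.
Hypothesis b_irr : forall g h, g \in H -> h \in H -> b = (g + h)%MM ->
  g = 0%MM \/ h = 0%MM.
Hypotheses (ba1 : b <> a1) (ba2 : b <> a2).

Local Notation A := (sgring K H).
Local Notation E := (quotmod (in_principal (K := K) (H := H) (R := R) b)).
Local Notation I := (@sgring_max K H).
Local Notation S := (res_mon H R b).
Local Notation pow_mon := (pow_mon H R b).
Local Notation shiftb := (shift a1 a2 b l1).
Local Notation C' := (coords_swap C).
Implicit Types (g h k c : mon).

Let omegaH : {subset omega R H <= H} := coords_omegaH C.
Let bH : b \in H := omegaH bO.

Variable T : seq mon.
Hypotheses (T_uniq : uniq T)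
  (TP : forall h, h \in T <-> S h /\ ~ exists2 g, S g & h = shiftb g).

Lemma colength_powmul n (L : seq mon) : uniq L ->
  (forall h, h \in L <-> S h /\ ~ pow_mon n h) ->
  is_colength (powmul E I n) (size L).
Proof.
move=> uL LP; rewrite (powmul_maxE K b omegaH).
exact: supp_in_colength (@pow_mon_upclosed H R b n) uL LP.
Qed.

Lemma colength_linear : exists n0 c : nat, forall n, (n0 <= n)%N ->
  is_colength (powmul E I n) (c + size T * (n - n0))%N.
Proof.
have enum n : exists L : seq mon, uniq L /\ forall h, h \in L <-> S h /\ ~ pow_mon n h.
  by have [L uL LP] := co_pow_enum C TP n; exists L.
have [L LP] := choice enum.
pose n0 := absz (l1 b + l2 b); exists n0, (size (L n0)) => n n0n.
suff -> : (size (L n0) + size T * (n - n0))%N = size (L n).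
  by have [uL Ln] := LP n; apply: colength_powmul.
rewrite -(subnK n0n) addnK; elim: (n - n0)%N => [|m IH]; first by rewrite muln0 addn0.
have [uL Lm] := LP (m + n0)%N; have [uL' Lm'] := LP (m + n0).+1.
rewrite addSn (co_pow_size C bO b_irr ba1 ba2 T_uniq TP _ uL uL' Lm Lm') -?IH; last first.
  by rewrite /n0; lia.
by rewrite mulnS; lia.
Qed.

Hypothesis S_nonempty : exists h, S h.

Lemma size_roots_gt0 : (0 < size T)%N.
Proof.
have exP : exists n, `[< exists2 h, S h & mdeg h = n >].
  by have [h hS] := S_nonempty; exists (mdeg h); apply/asboolP; exists h.
case: (ex_minnP exP) => n /asboolP[h hS hn] nmin.
suff : h \in T by case: (T).
apply/TP; split=> // -[g gS hE].
have : (n <= mdeg g)%N by apply/nmin/asboolP; exists g.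
rewrite -hn hE mdegD -[leqRHS]add0n leq_add2r leqn0 mdeg_eq0 => /eqP.
exact: ray_neq0 C g.
Qed.

Lemma multiplicity_size_roots : is_multiplicity I E (size T).
Proof.
have [n0 [c colen]] := colength_linear.
(* Since the multiplicity is defined with m^(n+1), the polynomial is c + N (n + 1 - n0), whence the
   extra N. Its degree is 1 because N is nonzero. *)
pose N : rat := (size T)%:R; pose c' : rat := c%:R + N - N * n0%:R.
have N0 : N != 0 by rewrite pnatr_eq0 -lt0n size_roots_gt0.
have sizeP : size (N%:P * 'X + c'%:P) = 2.
  by rewrite size_MXaddC polyC_eq0 (negPf N0) /= size_polyC N0.
exists 1%N, (N%:P * 'X + c'%:P); split=> //.
- exact (is_dim_E1 K C S_nonempty).
- exists n0 => n n0n; exists (c + size T * (n.+1 - n0))%N; split.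
    by apply: colen; apply: leqW.
  rewrite hornerD hornerM !hornerC hornerX natrD natrM natrB ?leqW // -natr1 /c' -/N; ring.
by rewrite lead_coefE sizeP coefD coefMX !coefC /= addr0 mulr1.
Qed.

(** The degree is forced by dim E = 1, and two consecutive large values give the slope. *)
Lemma multiplicity_unique e : is_multiplicity I E e -> e = size T.
Proof.
case=> d [P [dimE sizeP [n1 Pn] lead]].
have d1 := is_max_unique dimE (is_dim_E1 K C S_nonempty).
have [n0 [c colen]] := colength_linear.
pose n := (n0 + n1)%N.
have PE m : (n <= m)%N -> P.[m%:R] = (c + size T * (m.+1 - n0))%:R.
  move=> nm; have [|l [lE ->]] := Pn m; first by rewrite (leq_trans _ nm) ?leq_addl.
  congr (_%:R); apply: is_max_unique lE (colen _ _).
  by rewrite leqW // (leq_trans _ nm) ?leq_addr.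
have Plin x : P.[x] = P`_0 + P`_1 * x.
  by rewrite horner_coef sizeP d1 !big_ord_recr big_ord0 /= add0r expr0 mulr1 expr1.
have := PE n.+1 (leqnSn n); have := PE n (leqnn n).
rewrite !Plin -[n.+1%:R]natr1 => e1 e2.
have P1 : P`_1 = (size T)%:R.
  have -> : P`_1 = (P`_0 + P`_1 * (n%:R + 1)) - (P`_0 + P`_1 * n%:R) by ring.
  rewrite e1 e2 -natrB; last by rewrite leq_add2l leq_mul2l leq_sub2r ?orbT.
  congr (_%:R); rewrite /n; nia.
apply/eqP; rewrite -(eqr_nat rat) -lead lead_coefE sizeP d1 /= P1.
by rewrite factS fact0 muln1 mulr1.
Qed.

(** The monomial form of m E = (x^a1 + x^a2) E; the other inclusion always holds, by [shift_pow]. *)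
Definition mE_eq_shift : Prop :=
  forall h, S h -> pow_mon 1 h -> exists2 g, S g & h = shiftb g.

Lemma min_gens_size_roots : mE_eq_shift -> is_min_gens E (size T).
Proof.
move=> Q; split.
  exists (map (resX K H R b) T); split; first by rewrite size_map.
  apply: (pow_mon1_gens K omegaH) => [h /TP[]//|h hS].
  have [|[g gS ->]] := root_or_shift TP hS; first by left.
  by right; apply: (@shift_pow _ _ _ _ _ _ _ _ C 0).
move=> n [s [<- sE]]; apply: (min_gens_ge omegaH T_uniq _ sE) => h /TP[hS nh].
by split=> // /(Q h hS).
Qed.

(** The roots outside m E already generate, so a root inside m E would contradict minimality of size
    T. *)
Lemma mE_eq_shift_from_min_gens : is_min_gens E (size T) -> mE_eq_shift.
Proof.
case=> _ Tmin h hS h1; apply: contrapT => nh; have hT : h \in T by apply/TP.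
pose G := [seq g <- T | ~~ `[< pow_mon 1 g >]].
have : (size T <= size G)%N.
  apply: Tmin; exists (map (resX K H R b) G); split; first by rewrite size_map.
  apply: (pow_mon1_gens K omegaH) => [g|g gS]; first by rewrite mem_filter => /andP[_ /TP[]].
  have [g1|ng] := pselect (pow_mon 1 g); [by right | left].
  rewrite mem_filter; apply/andP; split; first exact/asboolPn.
  apply/TP; split=> // -[k kS gE]; apply: ng; rewrite gE.
  exact: (@shift_pow _ _ _ _ _ _ _ _ C 0).
rewrite leqNgt size_filter -(count_predC (fun g => ~~ `[< pow_mon 1 g >]) T).
rewrite -[ltnLHS]addn0 ltn_add2l -has_count; apply/negP; rewrite negbK.
by apply/hasP; exists h => //=; rewrite negbK; apply/asboolP.
Qed.

End Ulrich.

(** * Comparison with the condition on sums *)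

Section Main.
Variables (K : fieldType) (H : submonoid2) (R : realType).
Variables (a1 a2 b : mon) (l1 l2 : mon -> int) (D : int).
Hypothesis C : coords R H a1 a2 l1 l2 D.
Variable B : set mon.
Hypothesis HB : is_Hilbert_basis B H.
Hypotheses (Bb : B b) (ba1 : b <> a1) (ba2 : b <> a2).

Local Notation E := (quotmod (in_principal (K := K) (H := H) (R := R) b)).
Local Notation I := (@sgring_max K H).
Local Notation S := (res_mon H R b).
Local Notation shiftb := (shift a1 a2 b l1).
Local Notation C' := (coords_swap C).
Implicit Types (g h k c : mon).

Lemma Hilbert_basis_cases c : B c -> [\/ c = a1, c = a2 | c \in omega R H].
Proof.
move=> Bc; have /(mem_coordsP C) := Hilbert_basis_sub HB Bc.
rewrite !le_eqVlt => -[/orP[/eqP/esym c1|c1] /orP[/eqP/esym c2|c2]].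
- by apply: Or31; apply: (irreducible_face1 C (Hilbert_basis_irr HB)).
- by apply: Or31; apply: (irreducible_face1 C (Hilbert_basis_irr HB)).
- by apply: Or32; apply: (irreducible_face1 C' (Hilbert_basis_irr HB)).
- by apply: Or33; apply/(omega_coordsP C).
Qed.

Lemma Hilbert_basis_interior : b \in omega R H.
Proof. by case: (Hilbert_basis_cases Bb). Qed.

Let bO := Hilbert_basis_interior.
Let b_irr : forall g h, g \in H -> h \in H -> b = (g + h)%MM -> g = 0%MM \/ h = 0%MM.
Proof. by case: (Hilbert_basis_irr HB Bb). Qed.

Lemma mE_eq_shift_sum_condition :
  mE_eq_shift H R a1 a2 b l1 <-> sum_condition H a1 a2 b B.
Proof.
split=> [Q c1 c2 Bc1 Bc2|cond h hS h1].
  have tr g h : h \in H -> translate g H (g + h)%MM by move=> hH; exists h.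
  have c1H := Hilbert_basis_sub HB Bc1; have c2H := Hilbert_basis_sub HB Bc2.
  have [->|->|c1O] := Hilbert_basis_cases Bc1; first by left; right; apply: tr.
    by right; apply: tr.
  have [->|->|c2O] := Hilbert_basis_cases Bc2; first by left; right; rewrite addmC; apply: tr.
    by right; rewrite addmC; apply: tr.
  have [lt1|ge1] := ltP (l1 c1) (l1 b).
    left; apply: (condition_from_strip1 C bO b_irr _ c1O c2O lt1) => h hS hb /(Q h hS)[g gS hE].
    exists g => //; rewrite hE; have := hb; rewrite hE.
    have [[g1 r]|[_ g1 r]] := ray_cases C gS; rewrite /shift r // (coord1D C).
    by have := coord_gt0 C; rewrite (coord1_a2 C); lia.
  have [lt2|ge2] := ltP (l2 c1) (l2 b).
    suff : (translate b H `|` translate a2 H) (c1 + c2)%MM by case; [left; left|right].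
    apply: (condition_from_strip1 C' bO b_irr _ c1O c2O lt2) => h hS hb /(Q h hS)[g gS hE].
    exists g => //; rewrite hE; have := hb; rewrite hE.
    have [[g1 r]|[_ g1 r]] := ray_cases C gS; rewrite /shift r // (coord2D C).
    have := res_mon_disjoint C bO b_irr gS g1.
    by have := coord_gt0 C; rewrite (coord2_a1 C); lia.
  (* Here c1 lies in neither strip, so b divides c1 and hence the sum. *)
  have /(omega_coordsP C)[p1 p2] := c2O.
  by left; left; apply/(translate_coords C); rewrite (coord1D C) (coord2D C); lia.
have cond' : sum_condition H a2 a1 b B.
  by move=> c1 c2 Bc1 Bc2; case: (cond c1 c2 Bc1 Bc2) => [[|]|]; [left; left|right|left; right].
have Birr := Hilbert_basis_irr HB; have Bdiv := Hilbert_basis_div HB.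
have [[hb _]|[hb _ _]] := ray_cases C hS.
  have [g gS hE] := strip1_from_condition C bO b_irr ba1 ba2 Bdiv cond hS hb h1.
  by exists g => //; rewrite hE; apply: (shift_eq1 C); rewrite -hE.
have [g gS hE] := strip1_from_condition C' bO b_irr ba2 ba1 Bdiv cond' hS hb h1.
by exists g => //; rewrite hE; apply: (shift_eq2 C bO b_irr gS); rewrite -hE.
Qed.

(** A nonzero E has dimension and depth 1 and multiplicity size T in every case, so only its number
    of generators is at stake. *)
Lemma Ulrich_mE_eq_shift : is_Ulrich I E <-> mE_eq_shift H R a1 a2 b l1.
Proof.
have omegaH := coords_omegaH C; have bH := omegaH _ bO.
have [T uT TP] := shift_roots C bO b_irr ba1 ba2.
split=> [[E0|[_ [n [ngens nmult]]]]|Q].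
(* If E = 0 there is no residual exponent, as the class of x^h would be nonzero; the claim is
   vacuous. *)
- move=> h hS _; have := congr1 (fun v => rcoef v h) (E0 (resX K H R b h)).
  rewrite (rcoef_resX K omegaH) ?(res_mon_omega hS) // (rcoef0 K hS) eqxx => /eqP.
  by rewrite oner_eq0.
- move=> h hS; have Sne : exists h, S h by exists h.
  move: h hS; apply: (mE_eq_shift_from_min_gens (K := K) C TP).
  by rewrite -(multiplicity_unique C bO b_irr ba1 ba2 uT TP Sne nmult).
have [Sne|Sempty] := pselect (exists h, S h); last first.
  by left=> v; apply: rcoefP => h hS; case: Sempty; exists h.
right; split.
  by exists 1%N; split; [exact (is_dim_E1 K C Sne) | exact (is_depth_E1 K C bO b_irr ba1 ba2 Sne)].
exists (size T); split; first exact: (min_gens_size_roots K C uT TP Q).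
exact: (multiplicity_size_roots K C bO b_irr ba1 ba2 uT TP Sne).
Qed.

End Main.

Theorem theorem4p3 (R : realType) (K : fieldType) (H : submonoid2)
    (a1 a2 : 'X_{1..2}) (B : set 'X_{1..2}) (b : 'X_{1..2}) :
  is_normal_affine2 R H ->
  is_extremal_ray R H a1 -> is_extremal_ray R H a2 -> a1 <> a2 ->
  is_Hilbert_basis B H ->
  B b -> b <> a1 -> b <> a2 ->
  is_Ulrich_element K H R b <->
  (forall c1 c2, B c1 -> B c2 ->
     (translate b H `|` translate a1 H `|` translate a2 H) (c1 + c2)%MM).
Proof.
move=> nH r1 r2 a12 HB Bb ba1 ba2.
have [l1 [l2 [D C]]] := coords_exist nH r1 r2 a12.
have bO := Hilbert_basis_interior C HB Bb ba1 ba2.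
rewrite -[X in _ <-> X]/(sum_condition H a1 a2 b B).
rewrite -(propext (mE_eq_shift_sum_condition C HB Bb ba1 ba2)).
rewrite -(propext (Ulrich_mE_eq_shift K C HB Bb ba1 ba2)).
by split=> [[]|].
Qed.
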